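(* Let $\mathfrak{b}$ be a Borel subalgebra of the complex simple Lie algebra of type $F_4$. For each integer $m\geq 0$ let $N(m)$ be the number of abelian ideals of $\mathfrak{b}$ of dimension $m$. Then $$(N(0),N(1),\ldots,N(9))=(1,1,1,1,1,2,2,3,3,1)$$ and $N(m)=0$ for $m\geq 10$; the total number of abelian ideals of $\mathfrak{b}$ is $16$.
   Context: An abelian ideal of $\mathfrak{b}$ is an ideal $I$ of the Lie algebra $\mathfrak{b}$ with $[I,I]=0$ (the zero ideal is included); dimension is over $\mathbb{C}$. *)

(* Defs.v *)
From HB Require Import structures.
From mathcomp Require Import all_boot all_order all_algebra.
From mathcomp Require Import complex.
From mathcomp Require Import boolp classical_sets functions cardinality reals.

Set Implicit Arguments.
Unset Strict Implicit.
Unset Printing Implicit Defensive.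

Import GRing.Theory.
Local Open Scope ring_scope.

Record lieAlgebra (F : fieldType) := LieAlgebra {
  lie_sort :> vectType F;
  lie_br : lie_sort -> lie_sort -> lie_sort;
  lie_brDZl : forall (a : F) (x y z : lie_sort),
    lie_br (a *: x + y) z = a *: lie_br x z + lie_br y z;
  lie_brDZr : forall (a : F) (x y z : lie_sort),
    lie_br x (a *: y + z) = a *: lie_br x y + lie_br x z;
  lie_brxx : forall x : lie_sort, lie_br x x = 0;
  lie_jacobi : forall x y z : lie_sort,
    lie_br x (lie_br y z) + lie_br y (lie_br z x) + lie_br z (lie_br x y) = 0
}.

Section LieTheory.
Variables (F : fieldType) (L : lieAlgebra F).
Implicit Types (x y z : L) (A B I h b U : {vspace L}).

HB.instance Definition _ x :=
  GRing.isLinear.Build F L L *:%R (@lie_br F L x)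
    (fun a y z => lie_brDZr a x y z).

Definition ad x : 'End(L) := linfun (lie_br x).

Lemma adE x y : ad x y = lie_br x y.
Proof. by rewrite /ad lfunE. Qed.

Definition is_ideal b I : Prop :=
  (I <= b)%VS /\ forall x y, x \in b -> y \in I -> lie_br x y \in I.

Definition is_abelian A : Prop :=
  forall x y, x \in A -> y \in A -> lie_br x y = 0.

Definition is_abelian_ideal b I : Prop := is_ideal b I /\ is_abelian I.

Definition is_simple : Prop :=
  ~ is_abelian fullv /\ forall I, is_ideal fullv I -> I = 0%VS \/ I = fullv.

Definition ad_diagonalizable x : Prop :=
  exists2 s : seq L, basis_of fullv s &
    forall v, v \in s -> exists a : F, ad x v = a *: v.

(* Cartan subalgebra of a semisimple Lie algebra over an algebraically closed
   field of characteristic 0: abelian, equal to its own centralizer, and acting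
   diagonalizably in the adjoint representation. *)
Definition is_cartan h : Prop :=
  [/\ is_abelian h,
      forall x, (forall t, t \in h -> lie_br t x = 0) -> x \in h
    & forall t, t \in h -> ad_diagonalizable t].

(* The dual space of h. *)
Definition dual h := 'Hom(subvs_of h, F^o).

(* The space of all x such that [t, x] = alpha(t) x for every t in h (lemma
   rootspaceP); it suffices to let t range over a basis of h. *)
Definition rootspace h (alpha : dual h) : {vspace L} :=
  (\bigcap_(i < \dim h)
     passmx.leigenspace (ad (vbasis h)`_i) (alpha (vsproj h (vbasis h)`_i)))%VS.

Lemma rootspaceP h (alpha : dual h) x :
  reflect (forall t : subvs_of h, lie_br (vsval t) x = alpha t *: x)
          (x \in rootspace alpha).
Proof.
have brDl : forall a y z, lie_br (a *: y + z) x = a *: lie_br y x + lie_br z x.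
  by move=> a y z; exact: lie_brDZl.
have memE (i : 'I_(\dim h)) :
    (x \in passmx.leigenspace (ad (vbasis h)`_i) (alpha (vsproj h (vbasis h)`_i)))
  = (lie_br (vbasis h)`_i x == alpha (vsproj h (vbasis h)`_i) *: x).
  by rewrite memv_ker add_lfunE opp_lfunE scale_lfunE id_lfunE adE subr_eq0.
have bh (i : 'I_(\dim h)) : (vbasis h)`_i \in h.
  by apply/vbasis_mem/mem_nth; rewrite size_tuple.
apply: (iffP idP) => [|H]; last first.
  apply: (big_ind (fun U => x \in U)) => [|U V xU xV|i _].
  - exact: memvf.
  - by rewrite memv_cap xU.
  by rewrite memE; apply/eqP; rewrite -H vsprojK.
move=> xr t.
have Hi (i : 'I_(\dim h)) :
    lie_br (vbasis h)`_i x = alpha (vsproj h (vbasis h)`_i) *: x.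
  apply/eqP; rewrite -memE; move: x xr {brDl memE} => x.
  by apply/subvP; rewrite /rootspace (bigD1 i) //= capvSl.
have -> : t = \sum_(i < \dim h)
    coord (vbasis h) i (vsval t) *: vsproj h (vbasis h)`_i.
  rewrite -[LHS]vsvalK {1}(coord_vbasis (subvsP t)) linear_sum.
  by apply: eq_bigr => i _; rewrite linearZ.
have br0 : lie_br 0 x = 0.
  by have := brDl (-1) 0 0; rewrite scaler0 addr0 scaleN1r addNr.
rewrite !linear_sum scaler_suml.
rewrite (big_morph (fun y => lie_br y x) (id1 := 0) (op1 := +%R)) //; last first.
  by move=> y z; have := brDl 1 y z; rewrite !scale1r.
apply: eq_bigr => i _; rewrite !linearZ /= vsprojK //.
have := brDl (coord (vbasis h) i (vsval t)) (vbasis h)`_i 0.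
by rewrite !addr0 br0 addr0 => ->; rewrite Hi scalerA.
Qed.

Definition is_root h (alpha : dual h) : Prop :=
  alpha != 0 /\ rootspace alpha != 0%VS.

Definition nat_comb h (D : seq (dual h)) (alpha : dual h) : Prop :=
  exists c : 'I_(size D) -> nat, alpha = \sum_(i < size D) D`_i *+ c i.

(* D is a base (system of simple roots) of the root system of (L, h). *)
Definition is_base h (D : seq (dual h)) : Prop :=
  [/\ basis_of fullv D,
      forall alpha, alpha \in D -> is_root alpha
    & forall alpha, is_root alpha -> nat_comb D alpha \/ nat_comb D (- alpha)].

Definition is_positive_root h (D : seq (dual h)) (alpha : dual h) : Prop :=
  is_root alpha /\ nat_comb D alpha.

(* b is the sum of a Cartan subalgebra h and of the root spaces of the roots
   that are positive with respect to some base of the root system of (L, h)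
   (Bourbaki, Lie, VIII, 3.3). The sequence s lists the positive roots. *)
Definition is_borel b : Prop :=
  exists (h : {vspace L}) (D s : seq (dual h)),
    [/\ is_cartan h, is_base D,
        forall alpha, alpha \in s <-> is_positive_root D alpha
      & b = (h + \sum_(alpha <- s) rootspace alpha)%VS].

End LieTheory.

Section TypeF4.
Variable F : fieldType.

Definition e4 (i : 'I_4) : 'rV[F]_4 := delta_mx 0 i.

(* The 48 roots of F_4 in coordinates: +-e_i and (+-e_1 +- e_2 +- e_3 +- e_4)/2
   (short), +-e_i +- e_j with i <> j (long). *)
Definition F4_root (v : 'rV[F]_4) : Prop :=
  [\/ exists (s : bool) (i : 'I_4), v = (-1) ^+ s *: e4 i,
      exists (s t : bool) (i j : 'I_4),
        i != j /\ v = (-1) ^+ s *: e4 i + (-1) ^+ t *: e4 j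
    | exists s : 'I_4 -> bool, v = 2%:R^-1 *: \sum_i (-1) ^+ (s i) *: e4 i].

(* The root system of (L, h) is isomorphic to F_4: a linear isomorphism onto
   the dual of h carries one set of roots onto the other. Cartan integers need
   not be mentioned, since the set of roots determines the reflections. *)
Definition roots_of_type_F4 (L : lieAlgebra F) (h : {vspace L}) : Prop :=
  exists phi : 'Hom('rV[F]_4, dual h),
    [/\ lker phi = 0%VS, limg phi = fullv
      & forall alpha : dual h,
          is_root alpha <-> exists2 v, F4_root v & alpha = phi v].

(* The type of a semisimple Lie algebra over an algebraically closed field of
   characteristic 0 is that of its root system with respect to any Cartan
   subalgebra; these are all conjugate. *)
Definition of_type_F4 (L : lieAlgebra F) : Prop :=
  (exists h : {vspace L}, is_cartan h) /\
  forall h : {vspace L}, is_cartan h -> roots_of_type_F4 h.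

End TypeF4.

(* Main.v *)
From HB Require Import structures.
Require Import Defs.
From mathcomp Require Import all_boot all_order all_algebra.
From mathcomp Require Import complex.
From mathcomp Require Import boolp classical_sets functions cardinality reals.

(** An abelian ideal I of b is stable under the Cartan subalgebra h, hence is
    the sum of its weight components.  It meets h trivially: for t in I and h
    and a positive root vector e one has 0 = [t, [t, e]] = alpha(t)^2 e.  So I
    is a sum of positive root spaces, and once root spaces are known to be lines
    with [g_alpha, g_beta] nonzero whenever alpha + beta is a root, the abelian
    ideals are the sums of root spaces over the sets of positive roots that are
    closed under adding positive roots and contain no two roots whose sum is a
    root.  The dimension is the cardinality of the set.

    The two facts on root spaces come from one device, the cyclicity of the
    trace: if x and y are opposite root vectors, t = [x, y], and V is a sum of
    weight spaces stable under x and y, then the sum of the weights of V,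
    evaluated at t, vanishes (bracket_trace).  Taking for V a root string gives
    alpha(t) <> 0 (coroot_neq0), half a root string gives the nonvanishing of
    brackets (root_bracket_neq0), and a slight extension to a V that y does not
    preserve gives the multiplicity one (root_multiplicity1).  The existence of
    x and y with [x, y] <> 0 is the nondegeneracy of the Killing form; by
    simplicity its radical is 0 or everything, and the latter is excluded by
    evaluating it on h (killing_nondegenerate).

    It remains to count sets of roots.  The base that defines b is arbitrary, so
    its positive roots are brought to a standard list: among the systems of
    simple roots of F_4, take one minimizing the number of positive roots on
    which the height of the given base is negative; a simple root of negative
    height would allow a reflection decreasing this number
    (positive_simple_system).  For the standard list of 24 positive roots, the
    16 admissible sets are enumerated by computation (F4_abelian_sets). *)

Set Implicit Arguments.
Unset Strict Implicit.
Unset Printing Implicit Defensive.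
Import Order.TTheory GRing.Theory Num.Theory.
Local Open Scope ring_scope.

(** * Linear algebra *)

(** Subtracting the scalar chi w0 t from op t kills the component x w0, so that
    induction on the number of components applies. *)
Lemma commuting_components (F : fieldType) (V : vectType F) (T : Type)
    (op : T -> V -> V) (W : eqType) (chi : W -> T -> F) (X : {vspace V})
    (x : W -> V) (ws : seq W) :
  (forall w w', w != w' -> exists t, chi w t != chi w' t) ->
  (forall t, linear (op t)) ->
  (forall t v, v \in X -> op t v \in X) ->
  (forall w t, w \in ws -> op t (x w) = chi w t *: x w) ->
  uniq ws -> \sum_(w <- ws) x w \in X -> forall w, w \in ws -> x w \in X.
Proof.
move=> sep lin stab; elim: ws x => [|w0 ws IH] x //= xE /andP[w0n uws].
rewrite big_cons => xX.
have op0 t : op t 0 = 0.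
  by have := lin t (-1) 0 0; rewrite scaler0 addr0 scaleN1r addNr.
have addop t u v : op t (u + v) = op t u + op t v.
  by have := lin t 1 u v; rewrite !scale1r.
have opZ t a v : op t (a *: v) = a *: op t v.
  by have := lin t a v 0; rewrite op0 !addr0.
have xws w : w \in ws -> x w \in X.
  move=> wws; have ne : w != w0 by apply: contraNneq w0n => <-.
  have [t ht] := sep _ _ ne.
  suff : (chi w t - chi w0 t) *: x w \in X.
    by rewrite rpredZeq subr_eq0 (negPf ht).
  apply: (IH (fun w => (chi w t - chi w0 t) *: x w)) => //.
    move=> w1 t1 w1s.
    by rewrite opZ xE ?inE ?w1s ?orbT // !scalerA mulrC.
  have : op t (x w0 + \sum_(w <- ws) x w) - chi w0 t *: (x w0 + \sum_(w <- ws) x w) \in X.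
    by rewrite memvB ?memvZ ?stab ?xX ?orbT.
  rewrite addop xE ?inE ?eqxx // scalerDr opprD addrACA subrr add0r.
  rewrite (big_morph (op t) (addop t) (op0 t)) scaler_sumr -sumrB.
  rewrite (@eq_big_seq _ _ _ _ ws _ (fun i => (chi i t - chi w0 t) *: x i)) //.
  by move=> i iws; rewrite xE ?inE ?iws ?orbT // scalerBl.
move=> w; rewrite inE => /orP[/eqP->|/xws//].
have -> : x w0 = x w0 + \sum_(w <- ws) x w - \sum_(w <- ws) x w by rewrite addrK.
by rewrite memvB // big_seq memv_suml.
Qed.

Lemma spanning_seq_basis (F : fieldType) (V : vectType F) (X : seq V) :
  exists2 B : seq V, {subset B <= X} & free B /\ <<B>>%VS = <<X>>%VS.
Proof.
elim: X => [|v X [B BX [fB sB]]]; first by exists [::] => //; rewrite nil_free.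
have [vX|vX] := boolP (v \in <<X>>%VS).
  exists B; first by move=> u /BX; rewrite inE orbC => ->.
  by split=> //; rewrite span_cons sB; apply/esym/addv_idPr; rewrite -memvE.
exists (v :: B).
  by move=> u; rewrite !inE => /orP[->//|/BX->]; rewrite orbT.
by rewrite free_cons sB vX fB !span_cons sB.
Qed.

(** * The bracket and its weight spaces *)

Section Bracket.
Variables (F : fieldType) (L : lieAlgebra F).
Implicit Types (x y z : L) (a : F).
Local Notation br := (@lie_br F L).

Lemma lie_brC x y : br x y = - br y x.
Proof.
have brDl u v w : br (u + v) w = br u w + br v w.
  by have := lie_brDZl 1 u v w; rewrite !scale1r.
have := lie_brxx (x + y); rewrite linearD /= !brDl !lie_brxx add0r addr0.
by move/eqP; rewrite addrC addr_eq0 => /eqP.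
Qed.

(** The bracket with its arguments swapped, so that the linearity in the first
    argument can be recorded as a structure. *)
Definition lie_br_to y x := br x y.

Lemma lie_br_to_linear y : linear (lie_br_to y).
Proof. by move=> a u v; exact: lie_brDZl. Qed.

HB.instance Definition _ y :=
  GRing.isLinear.Build F L L *:%R (lie_br_to y) (lie_br_to_linear y).

Lemma lie_brDl x y z : br (x + y) z = br x z + br y z.
Proof. exact: (linearD (lie_br_to z)). Qed.
Lemma lie_brZl a x z : br (a *: x) z = a *: br x z.
Proof. exact: (linearZ_LR (lie_br_to z)). Qed.
Lemma lie_br0l z : br 0 z = 0.
Proof. exact: (linear0 (lie_br_to z)). Qed.
Lemma lie_br_suml I r (P : pred I) (f : I -> L) z :
  br (\sum_(i <- r | P i) f i) z = \sum_(i <- r | P i) br (f i) z.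
Proof. exact: (linear_sum (lie_br_to z)). Qed.

Lemma lie_br_der x y z : br x (br y z) = br (br x y) z + br y (br x z).
Proof.
have := lie_jacobi x y z; rewrite (lie_brC z (br x y)) (lie_brC z x) linearN.
by move/eqP; rewrite subr_eq0 subr_eq => /eqP.
Qed.

Lemma lie_br_br x y z : br (br x y) z = br x (br y z) - br y (br x z).
Proof. by rewrite lie_br_der addrK. Qed.

End Bracket.

Section WeightSpaces.
Variables (F : fieldType) (L : lieAlgebra F) (h : {vspace L}).
Implicit Types (alpha beta : dual h) (x y t : L).
Local Notation br := (@lie_br F L).

Lemma rootspace_act alpha x t (th : t \in h) :
  x \in rootspace alpha -> br t x = alpha (vsproj h t) *: x.
Proof. by move/rootspaceP/(_ (vsproj h t)); rewrite vsprojK. Qed.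

Lemma rootspace_br alpha beta x y :
  x \in rootspace alpha -> y \in rootspace beta ->
  br x y \in rootspace (alpha + beta).
Proof.
move=> /rootspaceP xa /rootspaceP yb; apply/rootspaceP => t.
by rewrite lie_br_der xa yb linearZ /= lie_brZl -scalerDl add_lfunE.
Qed.

Lemma rootspace0 (hc : is_cartan h) : rootspace (0 : dual h) = h.
Proof.
have [hab hself _] := hc.
apply/vspaceP => x; apply/rootspaceP/idP => [x0|xh t].
  by apply: hself => t th; rewrite -(vsprojK th) x0 zero_lfunE scale0r.
by rewrite zero_lfunE scale0r hab ?subvsP.
Qed.

Lemma dual_separates alpha beta : alpha != beta -> exists t : subvs_of h, alpha t != beta t.
Proof.
move=> ne; apply: contrapT => /forallNP eqab; case/eqP: ne; apply/lfunP => t.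
by apply/eqP; apply: contra_notT (eqab t).
Qed.

(** The simultaneous diagonalization of h.  An eigenvector u of the elements
    already treated is split along the eigenspaces of the next element t; as t
    commutes with these elements, it preserves their eigenspaces through u, and
    so the pieces of u remain eigenvectors for them. *)
Lemma cartan_eigensum (hc : is_cartan h) (ts : seq L) x :
  {subset ts <= h} ->
  exists2 X : seq L, x = \sum_(u <- X) u &
    forall u, u \in X -> forall t, t \in ts -> exists a, br t u = a *: u.
Proof.
elim: ts x => [|t ts IH] x sub; first by exists [:: x]; rewrite ?big_seq1.
have [hab _ hdiag] := hc.
have th : t \in h by apply: sub; rewrite inE eqxx.
have subts : {subset ts <= h} by move=> u uts; apply: sub; rewrite inE uts orbT.
have [X -> Xts] := IH x subts.
suff split u : u \in X -> exists2 Y : seq L, u = \sum_(v <- Y) v &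
    forall v, v \in Y -> forall s, s \in t :: ts -> exists a, br s v = a *: v.
  move: X Xts split {x} => X _; elim: X => [|u X IHX] split.
    by exists [::] => //; rewrite big_nil.
  have [|Y1 E1 H1] := IHX; first by move=> v vX; apply: split; rewrite inE vX orbT.
  have [|Y2 E2 H2] := split u; first by rewrite inE eqxx.
  exists (Y2 ++ Y1); first by rewrite big_cons big_cat -E1 -E2.
  by move=> v; rewrite mem_cat => /orP[/H2|/H1].
move=> uX; have {}Xts := Xts u uX.
have [s sb sE] := hdiag t th.
pose P v (a : F) := br t v = a *: v.
have [lam lamP] : {lam : L -> F & forall v, v \in s -> P v (lam v)}.
  apply: (@choice _ _ (fun v a => v \in s -> P v a)) => v.
  have [vs|] := boolP (v \in s); last by exists 0.
  by have [a Ha] := sE _ vs; exists a => _; rewrite /P -adE.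
pose c i := coord (in_tuple s) i u.
have uE : u = \sum_i c i *: s`_i.
  exact: (coord_basis (X := in_tuple s) sb (memvf u)).
pose ws := undup [seq lam v | v <- s].
pose comp (k : F) := \sum_(i < size s | lam s`_i == k) c i *: s`_i.
have uE' : u = \sum_(k <- ws) comp k.
  rewrite /comp (exchange_big_dep predT) //= {1}uE; apply: eq_bigr => i _.
  rewrite -big_filter (_ : [seq k <- ws | _] = [:: lam s`_i]) ?big_seq1 //.
  rewrite (eq_filter (a2 := pred1 (lam s`_i))); last by move=> k /=; rewrite eq_sym.
  by rewrite filter_pred1_uniq ?undup_uniq // mem_undup map_f ?mem_nth.
have compE k : br t (comp k) = k *: comp k.
  rewrite linear_sum scaler_sumr; apply: eq_bigr => i /eqP <-.
  by rewrite linearZ /= lamP ?mem_nth // !scalerA mulrC.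
exists [seq comp k | k <- ws]; first by rewrite big_map.
move=> v /mapP[k kws ->] s'; rewrite inE => /orP[/eqP->|s'ts].
  by exists k.
have [a Ha] := Xts s' s'ts; exists a.
pose E := lker (ad s' - a *: \1%VF).
have EP y : (y \in E) = (br s' y == a *: y).
  by rewrite memv_ker add_lfunE opp_lfunE scale_lfunE id_lfunE adE subr_eq0.
apply/eqP; rewrite -EP.
apply: (@commuting_components _ _ unit (fun _ => br t) _ (fun k _ => k) E comp ws) => //.
- by move=> _ b y z; rewrite linearD linearZ.
- move=> _ y; rewrite !EP => /eqP yE.
  by rewrite lie_br_der (hab _ _ (subts _ s'ts) th) lie_br0l add0r yE linearZ.
- exact: undup_uniq.
by rewrite -uE' EP Ha.
Qed.

(** The eigenvalue of t on x is the coordinate of [t, x] on the basis x of its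
    line, hence depends linearly on t. *)
Lemma weight_of (x : L) :
  x != 0 -> (forall t, t \in h -> exists a, br t x = a *: x) ->
  exists alpha : dual h, x \in rootspace alpha.
Proof.
move=> x0 eig.
have fx : free [tuple x] by rewrite seq1_free.
pose al (t : subvs_of h) : F^o := coord [tuple x] ord0 (br (vsval t) x).
have al_lin : linear al.
  by move=> a u v; rewrite /al linearP /= lie_brDZl linearP.
pose alL := GRing.isLinear.Build F (subvs_of h) F^o *:%R al al_lin.
pose alF : {linear subvs_of h -> F^o} := HB.pack al alL.
exists (linfun alF); apply/rootspaceP => t.
have [a Ha] := eig _ (subvsP t).
rewrite lfunE /= /al Ha linearZ /=.
by rewrite -[X in coord _ _ X]/([tuple x]`_(@ord0 0)) coord_free // eqxx mulr1.
Qed.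

Lemma cartan_weight_basis (hc : is_cartan h) :
  exists (n : nat) (B : n.-tuple L) (W : 'I_n -> dual h),
    basis_of fullv B /\ forall i : 'I_n, B`_i \in rootspace (W i).
Proof.
have hts : {subset vbasis h <= h} by move=> u; exact: vbasis_mem.
have [f fP] : {f : L -> seq L & forall x, x = \sum_(u <- f x) u /\
    (forall u, u \in f x -> forall t, t \in vbasis h -> exists a, br t u = a *: u)}.
  apply: (@choice _ _ (fun x (X : seq L) => x = \sum_(u <- X) u /\
    forall u, u \in X -> forall t, t \in vbasis h -> exists a, br t u = a *: u)) => x.
  by have [X ? ?] := cartan_eigensum hc x hts; exists X.
pose X := flatten [seq f x | x <- vbasis (fullv : {vspace L})].
have [B BX [fB sB]] := spanning_seq_basis X.
have spanX : <<X>>%VS = fullv.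
  apply/eqP; rewrite eqEsubv subvf /= -(span_basis (vbasisP fullv)).
  apply/span_subvP => x xb; have [-> _] := fP x.
  rewrite big_seq; apply: memv_suml => u ux; apply: memv_span.
  by apply/flattenP; exists (f x) => //; apply: map_f.
have eig x t : x \in B -> t \in h -> exists a, br t x = a *: x.
  move=> /BX/flattenP[_ /mapP[y _ ->] xy] th.
  have [_ /(_ x xy) H] := fP y.
  have [a Ha] : {a : L -> F & forall t, t \in vbasis h -> br t x = a t *: x}.
    apply: (@choice _ _ (fun t a => t \in vbasis h -> br t x = a *: x)) => t'.
    have [/H[a]|] := boolP (t' \in vbasis h); first by exists a.
    by exists 0.
  exists (\sum_(i < \dim h) coord (vbasis h) i t * a (vbasis h)`_i).
  rewrite {1}(coord_vbasis th) lie_br_suml scaler_suml; apply: eq_bigr => i _.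
  by rewrite lie_brZl Ha ?scalerA // mem_nth // size_tuple.
have [w wP] : {w : L -> dual h & forall x, x \in B -> x \in rootspace (w x)}.
  apply: (@choice _ _ (fun x a => x \in B -> x \in rootspace a)) => x.
  have [xB|] := boolP (x \in B); last by exists 0.
  have x0 := free_not0 fB xB.
  by have [a] := weight_of x0 (fun t => eig x t xB); exists a.
exists (size B), (in_tuple B), (fun i => w B`_i); split.
  by rewrite /basis_of /= sB spanX eqxx fB.
by move=> i; apply/wP/mem_nth.
Qed.

End WeightSpaces.

(** * Traces along weights *)

Section Weights.
Variables (F : numFieldType) (L : lieAlgebra F) (h : {vspace L}).
Variables (n : nat) (B : n.-tuple L) (W : 'I_n -> dual h).
Hypothesis hc : is_cartan h.
Hypothesis Bb : basis_of fullv B.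
Hypothesis BW : forall i : 'I_n, B`_i \in rootspace (W i).
Implicit Types (alpha beta : dual h) (x y z : L) (p q : pred 'I_n).
Local Notation br := (@lie_br F L).
Local Notation co := (coord B).

Lemma coordB (i j : 'I_n) : co i B`_j = (j == i)%:R.
Proof. by rewrite coord_free // (basis_free Bb). Qed.

Lemma coord_expand x : x = \sum_i co i x *: B`_i.
Proof. exact: coord_basis Bb (memvf x). Qed.

Lemma coord_ext x y : (forall i, co i x = co i y) -> x = y.
Proof.
by move=> e; rewrite (coord_expand x) (coord_expand y); apply: eq_bigr => i _; rewrite e.
Qed.

Lemma coord_cartan (t : subvs_of h) i x : co i (br (vsval t) x) = W i t * co i x.
Proof.
rewrite {1}(coord_expand x) linear_sum /= linear_sum (bigD1 i) //= big1 => [|j ji];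
  move/rootspaceP: (BW i) => BWi.
  by rewrite linearZ /= BWi !linearZ /= coordB eqxx mulr1 addr0 mulrC.
move/rootspaceP: (BW j) => BWj.
by rewrite linearZ /= BWj !linearZ /= coordB (negPf ji) !mulr0.
Qed.

Definition supported p x := forall i, ~~ p i -> co i x = 0.

Lemma supported_sum p x : supported p x -> x = \sum_(i | p i) co i x *: B`_i.
Proof.
move=> px; rewrite {1}(coord_expand x) (bigID p) /= [X in _ + X]big1 ?addr0 //.
by move=> i /px->; rewrite scale0r.
Qed.

Lemma rootspace_supported gamma x :
  x \in rootspace gamma <-> supported (fun i => W i == gamma) x.
Proof.
split=> [/rootspaceP xg i /dual_separates[t ne]|xs].
  have := coord_cartan t i x; rewrite xg linearZ /= => /eqP.
  by rewrite -subr_eq0 -mulrBl mulf_eq0 subr_eq0 eq_sym (negPf ne) => /eqP.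
apply/rootspaceP => t; apply: coord_ext => i; rewrite coord_cartan linearZ /=.
by have [<-//|/xs->] := eqVneq (W i) gamma; rewrite !mulr0.
Qed.

Lemma supported_br p alpha x i :
  x \in rootspace alpha -> (forall j, W j = W i + alpha -> p j) ->
  supported p (br x B`_i).
Proof.
move=> xa pj j npj; have /rootspace_supported := rootspace_br xa (BW i).
by apply; apply: contraNneq npj => Wj; apply: pj; rewrite Wj addrC.
Qed.

(** The cyclicity of the trace, for maps going back and forth between the
    coordinate subspaces of q and of p: both sides are the sum of the products
    of the entries (i, j) of f and (j, i) of g. *)
Lemma trace_cyclic p q (f g : {linear L -> L}) :
  (forall i : 'I_n, q i -> supported p (g B`_i)) ->
  (forall j : 'I_n, p j -> supported q (f B`_j)) ->
  \sum_(i | q i) co i (f (g B`_i)) = \sum_(j | p j) co j (g (f B`_j)).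
Proof.
move=> gp fq.
under eq_bigr => i qi do
  rewrite {1}(supported_sum (gp i qi)) linear_sum linear_sum /=.
under [RHS]eq_bigr => j pj do
  rewrite {1}(supported_sum (fq j pj)) linear_sum linear_sum /=.
rewrite exchange_big /=; apply: eq_bigr => j pj; apply: eq_bigr => i qi.
by rewrite !linearZ /= mulrC.
Qed.

Lemma coord_commutator x y (t : subvs_of h) (i : 'I_n) : br x y = vsval t ->
  W i t = co i (br x (br y B`_i)) - co i (br y (br x B`_i)).
Proof.
by move=> xyt; rewrite -linearB /= -lie_br_br xyt coord_cartan coordB eqxx mulr1.
Qed.

(** A commutator has trace 0 on a subspace that x and y preserve, and t acts on
    weight vectors by their weights. *)
Lemma bracket_trace p x y (t : subvs_of h) : br x y = vsval t ->
  (forall i : 'I_n, p i -> supported p (br x B`_i)) ->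
  (forall i : 'I_n, p i -> supported p (br y B`_i)) ->
  \sum_(i | p i) W i t = 0.
Proof.
move=> xyt xp yp; under eq_bigr => i _ do rewrite (coord_commutator i xyt).
by rewrite sumrB (trace_cyclic (f := br x) (g := br y) yp xp) subrr.
Qed.

Lemma rootspace_opp_br alpha x y :
  x \in rootspace alpha -> y \in rootspace (- alpha) -> br x y \in h.
Proof.
by move=> xa ya; have := rootspace_br xa ya; rewrite subrr rootspace0.
Qed.

(** * Nondegeneracy of the Killing form *)

Definition killing x y := \sum_i co i (br x (br y B`_i)).

(** Both sides are a difference of traces of triple products, equal up to a
    cyclic permutation. *)
Lemma killing_br x y z : killing (br x y) z = killing x (br y z).
Proof.
pose tr3 x y z := \sum_i co i (br x (br y (br z B`_i))).
have E1 : killing (br x y) z = tr3 x y z - tr3 y x z.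
  rewrite -sumrB; apply: eq_bigr => i _.
  by rewrite lie_br_br linearB.
have E2 : killing x (br y z) = tr3 x y z - tr3 x z y.
  rewrite -sumrB; apply: eq_bigr => i _.
  by rewrite lie_br_br !linearB.
rewrite E1 E2; congr (_ - _).
exact: (trace_cyclic (p := predT) (q := predT) (f := br y) (g := br x \o br z)).
Qed.

Lemma killing_linearl z : linear (killing^~ z : L -> F^o).
Proof.
move=> a x y; rewrite /killing scaler_sumr -big_split; apply: eq_bigr => i _ /=.
by rewrite lie_brDZl linearP.
Qed.

Lemma killing_linearr x : linear (killing x : L -> F^o).
Proof.
move=> a y z; rewrite /killing scaler_sumr -big_split; apply: eq_bigr => i _ /=.
by rewrite lie_brDZl linearP /= linearP.
Qed.

Lemma killing_cartan (t t' : subvs_of h) :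
  killing (vsval t) (vsval t') = \sum_i W i t * W i t'.
Proof.
by apply: eq_bigr => i _; rewrite !coord_cartan coordB eqxx mulr1.
Qed.

Hypothesis g_simple : is_simple L.

Variable height : {linear dual h -> F^o}.
Hypothesis height_real : forall i, height (W i) \is Num.real.
Hypothesis height_eq0 : forall i, height (W i) = 0 -> W i = 0.

(** The line through a central element is an ideal. *)
Lemma central_eq0 x : (forall i : 'I_n, br x B`_i = 0) -> x = 0.
Proof.
move=> xB; have xz z : br x z = 0.
  by rewrite (coord_expand z) linear_sum big1 // => i _; rewrite linearZ /= xB scaler0.
have [nab ideals] := g_simple; apply/eqP.
have [||E] := ideals <[x]>%VS; last 2 first.
- by move=> E; have := memv_line x; rewrite E memv0.
- case: nab => u v; rewrite -E => /vlineP[a ->] _.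
  by rewrite lie_brZl xz scaler0.
split; first exact: subvf.
by move=> u v _ /vlineP[a ->]; rewrite linearZ /= lie_brC xz oppr0 scaler0 mem0v.
Qed.

(** The radical is an ideal.  If it were everything, then the sum of the
    W_i(t) W_i(t') would vanish for all t and t' in h, which says that
    the sum of the W_i tensor W_i is 0; evaluating both factors at the
    height makes the sum of the squares of the real numbers height(W_i) vanish.
    All weights would be 0, and L would be equal to its abelian subalgebra h. *)
Lemma killing_nondegenerate x : (forall y, killing x y = 0) -> x = 0.
Proof.
pose kx z := \row_i killing z B`_i : 'rV[F]_n.
have kx_lin : linear kx.
  by move=> a u v; apply/rowP => i; rewrite !mxE; exact: killing_linearl.
pose kxL := GRing.isLinear.Build F L 'rV[F]_n *:%R kx kx_lin.
pose kxF : {linear L -> 'rV[F]_n} := HB.pack kx kxL.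
pose rad := lker (linfun kxF).
have killing_lin z : {f : {linear L -> F^o} | f =1 killing z}.
  have zl := GRing.isLinear.Build F L F^o *:%R (killing z) (@killing_linearr z).
  by exists (HB.pack (killing z) zl : {linear L -> F^o}).
have radP z : (z \in rad) <-> forall y, killing z y = 0.
  rewrite memv_ker lfunE /=; split=> [/eqP/rowP k0 y|k0]; last first.
    by apply/eqP/rowP => i; rewrite !mxE k0.
  have [f fE] := killing_lin z.
  rewrite -fE (coord_expand y) linear_sum big1 // => i _.
  by rewrite linearZ /= fE; have := k0 i; rewrite !mxE => ->; rewrite scaler0.
have [nab ideals] := g_simple.
have [||E] := ideals rad; last 2 first.
- by move=> E /radP; rewrite E memv0 => /eqP.
- case: nab; have W0 i : W i = 0.
    have sumW0 (t : subvs_of h) : \sum_j W j t *: W j = 0.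
      apply/lfunP => t'; rewrite sum_lfunE zero_lfunE.
      under eq_bigr => j _ do rewrite scale_lfunE.
      have /radP/(_ (vsval t')) : vsval t \in rad by rewrite E memvf.
      by rewrite killing_cartan.
    have sumH0 : \sum_j height (W j) *: W j = 0.
      apply/lfunP => t; rewrite sum_lfunE zero_lfunE.
      have /(congr1 height) := sumW0 t; rewrite linear0 linear_sum => H.
      rewrite -[RHS]H; apply: eq_bigr => j _.
      by rewrite scale_lfunE linearZ; exact: mulrC.
    apply: height_eq0.
    have /(congr1 height) := sumH0; rewrite linear0 linear_sum => H.
    have := H; under eq_bigr => j _ do rewrite linearZ /=.
    move/psumr_eq0P => /(_ _ i isT) H0.
    apply/eqP; rewrite -sqrf_eq0 expr2; apply/eqP; apply: H0 => j _.
    by rewrite -realEsqr // -expr2.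
  have fh u : u \in h.
    rewrite -(rootspace0 hc); apply/rootspace_supported => j.
    by rewrite W0 eqxx.
  by move=> u v _ _; case: hc => hab _ _; apply: hab.
split; first exact: subvf.
move=> u v _ /radP v0; apply/radP => z.
have [f fE] := killing_lin v.
rewrite lie_brC.
have := killing_linearl z (-1) (br v u) 0.
rewrite addr0 !scaleN1r killing_br v0 oppr0 add0r => ->.
by rewrite /killing big1 // => i _; rewrite lie_br0l linear0.
Qed.

(** If x commutes with the opposite root space, then
    alpha(t) kappa(x, y) = kappa([t, x], y) = kappa(t, [x, y]) = 0 for y in that
    space, and x is orthogonal to the other weight spaces by invariance. *)
Lemma opposite_root_vector alpha x : alpha != 0 -> x \in rootspace alpha ->
  x != 0 -> exists2 y, y \in rootspace (- alpha) & br x y != 0.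
Proof.
move=> a0 xa; apply: contraNP => ny.
have xy0 y : y \in rootspace (- alpha) -> br x y = 0.
  by move=> ya; apply: contrapT => /eqP xy; apply: ny; exists y.
have kN u v : killing (- u) v = - killing u v.
  rewrite /killing -sumrN; apply: eq_bigr => i _.
  by rewrite -scaleN1r lie_brZl scaleN1r linearN.
have kZ a u v : killing (a *: u) v = a * killing u v.
  rewrite /killing mulr_sumr; apply: eq_bigr => i _.
  by rewrite lie_brZl linearZ.
have kZr a u v : killing u (a *: v) = a * killing u v.
  rewrite /killing mulr_sumr; apply: eq_bigr => i _.
  by rewrite lie_brZl !linearZ.
have kB (j : 'I_n) : killing x B`_j = 0.
  have [Wj|] := eqVneq (W j) (- alpha); last first.
    case/dual_separates => t; rewrite opp_lfunE -addr_eq0 => ne.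
    have := killing_br x (vsval t) B`_j.
    rewrite lie_brC kN; move/rootspaceP: (BW j) => ->; move/rootspaceP: xa => ->.
    rewrite kZ kZr => /eqP; rewrite -subr_eq0 -opprD oppr_eq0 -mulrDl mulf_eq0 addrC.
    by rewrite (negPf ne) => /eqP.
  have [t] := dual_separates a0; rewrite zero_lfunE => ne.
  have := killing_br (vsval t) x B`_j; rewrite xy0 -?Wj ?BW //.
  move/rootspaceP: xa => ->; rewrite kZ.
  rewrite {2}/killing big1 => [/eqP|i _]; last by rewrite lie_br0l !linear0.
  by rewrite mulf_eq0 (negPf ne) => /eqP.
apply/eqP; apply: killing_nondegenerate => y.
rewrite (coord_expand y).
elim/big_ind: _ => [|u v ku kv|i _]; last by rewrite kZr kB mulr0.
  by rewrite /killing big1 // => i _; rewrite lie_br0l !linear0.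
have -> : killing x (u + v) = killing x u + killing x v.
  by rewrite -big_split; apply: eq_bigr => i _; rewrite lie_brDl !linearD.
by rewrite ku kv addr0.
Qed.

(** * Root strings *)

(** Otherwise all weights of the alpha-string through W_i take the same value at
    t, while the trace of t on the string is 0.  So W_i(t) = 0 for every i, and t
    is central. *)
Lemma coroot_neq0 alpha x y (t : subvs_of h) :
  x \in rootspace alpha -> y \in rootspace (- alpha) ->
  br x y = vsval t -> br x y != 0 -> alpha t != 0.
Proof.
move=> xa ya xyt; apply: contraNneq => at0; rewrite xyt.
apply/eqP/central_eq0 => i.
move/rootspaceP: (BW i) => ->.
suff -> : W i t = 0 by rewrite scale0r.
pose p j := `[< exists k : int, W j = W i + alpha *~ k >].
have pt j : p j -> W j t = W i t.
  by move/asboolP => [k ->]; rewrite add_lfunE -scaler_int scale_lfunE at0 scaler0 addr0.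
have : \sum_(j | p j) W j t = 0.
  apply: (bracket_trace xyt) => j /asboolP[k Wj].
  - apply: (supported_br xa) => j' Wj'; apply/asboolP; exists (k + 1).
    by rewrite Wj' Wj mulrzDr addrA.
  - apply: (supported_br ya) => j' Wj'; apply/asboolP; exists (k - 1).
    by rewrite Wj' Wj mulrzBr addrA.
rewrite (eq_bigr (fun=> W i t)) // sumr_const => /eqP; rewrite mulrn_eq0.
case/orP => [/eqP/card0_eq/(_ i)|/eqP//].
by case/asboolP; exists 0; rewrite mulr0z addr0.
Qed.

Definition is_weight alpha := exists i, W i = alpha.

(** Let q index the weights alpha, 2 alpha, and so on, and let p add to them
    the weight 0.  Then y maps the space of q to that of p and x maps the space
    of p to that of q, so that trace_cyclic applies.  On the space of q the
    difference between the two traces is the sum of the weights at t, and the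
    extra contribution of the zero weight space is the trace of
    k |-> alpha(k) t on h, which is alpha(t).  Dividing by alpha(t), the sum of
    dim g_{m alpha} times m over m > 0 is 1. *)
Lemma root_multiplicity1 i j : W i != 0 -> W i = W j -> i = j.
Proof.
set alpha := W i => a0 Wij.
have Bi0 : B`_i != 0 by rewrite (free_not0 (basis_free Bb)) // mem_nth ?size_tuple.
have xa : B`_i \in rootspace alpha by apply: BW.
move: B`_i xa Bi0 => x xa x0.
have [y ya xy0] := opposite_root_vector a0 xa x0.
pose t := vsproj h (br x y).
have tE : br x y = vsval t by rewrite vsprojK // (rootspace_opp_br xa).
have at0 := coroot_neq0 xa ya tE xy0.
pose q j := `[< exists k : nat, W j = alpha *+ k.+1 >].
pose r j := W j == 0.
have qt k : q k -> exists m : nat, W k t = alpha t * m.+1%:R.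
  move/asboolP => [m ->]; exists m.
  by rewrite -scaler_nat scale_lfunE /= mulrC.
have trq : \sum_(k | q k) W k t = alpha t.
  have qNr k : q k -> ~~ r k.
    move=> /qt[m Wk]; apply/negP => /eqP W0; move/eqP: Wk.
    by rewrite W0 zero_lfunE eq_sym mulf_eq0 pnatr_eq0 orbF (negPf at0).
  pose p k := q k || r k.
  have yq (k : 'I_n) : q k -> supported p (br y B`_k).
    move=> /asboolP[m Wk]; apply: (supported_br ya) => k' Wk'.
    move: Wk'; rewrite Wk mulrSr addrK.
    case: m {Wk} => [|m] Wk'; apply/orP; [right; exact/eqP | left].
    by apply/asboolP; exists m.
  have xp (k : 'I_n) : p k -> supported q (br x B`_k).
    move=> pk; apply: (supported_br xa) => k' Wk'.
    apply/asboolP; rewrite Wk'.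
    case/orP: pk => [/asboolP[m ->]|/eqP->].
      by exists m.+1; rewrite [RHS]mulrSr.
    by exists 0%N; rewrite add0r.
  have := trace_cyclic (f := br x) (g := br y) yq xp.
  rewrite [X in _ = X -> _](bigID q) /= /p.
  rewrite [X in _ = X + _](eq_bigl q) => [|k]; last first.
    by case: (q k); rewrite ?andbT ?andbF.
  rewrite [X in _ = _ + X](eq_bigl r) => [|k]; last first.
    have := qNr k; case: (q k) => /= H; last by rewrite andbT.
    by rewrite (negPf (H isT)).
  move/eqP; rewrite addrC -subr_eq -sumrB => /eqP E.
  under eq_bigr => k _ do rewrite (coord_commutator k tE).
  rewrite E.
  (* The trace of k |-> alpha(k) t on h. *)
  have th : supported r (vsval t).
    by apply/rootspace_supported; rewrite rootspace0 ?subvsP.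
  rewrite -[RHS](congr1 alpha (vsvalK t)) (supported_sum th) !linear_sum; apply: eq_bigr => k /eqP Wk.
  have Bkh : B`_k \in h by rewrite -(rootspace0 hc) -Wk BW.
  rewrite (lie_brC x) (rootspace_act Bkh xa) !linearN !linearZ /= lie_brC tE.
  by rewrite linearN mulrN opprK; exact: mulrC.
have pi : q i by apply/asboolP; exists 0%N; rewrite mulr1n.
have pj : q j by apply/asboolP; exists 0%N; rewrite mulr1n.
(* All terms are positive and those at i and j are 1, so i <> j is absurd. *)
have : \sum_(k | q k) W k t / alpha t = 1 by rewrite -mulr_suml trq divff.
apply: contra_eq => ij; rewrite (bigD1 i) //= (bigD1 j) /=; last by rewrite pj eq_sym.
rewrite -Wij divff //; apply/negP => /eqP; rewrite -[RHS]addr0 => /addrI.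
apply/eqP; rewrite gt_eqF // ltr_wpDr // sumr_ge0 // => k /andP[/andP[/qt[m ->] _] _].
by rewrite mulrAC divff // mul1r ler0n.
Qed.

(** If x kills g_beta, then the part of the alpha-string through beta that goes
    down from beta is stable under x and y, like the whole string, so t has
    trace 0 on both.  The former gives beta(t) / alpha(t) >= 0, as this is an
    average of natural numbers.  On the rest of the string, which contains
    alpha + beta, the weights at t are then positive multiples of alpha(t), and
    their sum cannot be 0. *)
Lemma root_bracket_neq0 alpha beta : alpha != 0 -> is_weight alpha ->
  is_weight beta -> is_weight (alpha + beta) ->
  exists x z, [/\ x \in rootspace alpha, z \in rootspace beta & br x z != 0].
Proof.
move=> a0 [i0 Wi0] [i1 Wi1] [i2 Wi2]; apply: contrapT => none.
have xz0 x z : x \in rootspace alpha -> z \in rootspace beta -> br x z = 0.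
  by move=> xa zb; apply: contrapT => /eqP xz; apply: none; exists x, z.
have xa : B`_i0 \in rootspace alpha by rewrite -Wi0 BW.
have x0 : B`_i0 != 0 by rewrite (free_not0 (basis_free Bb)) // mem_nth ?size_tuple.
move: B`_i0 xa x0 => x xa x0 {i0 Wi0}.
have [y ya xy0] := opposite_root_vector a0 xa x0.
pose t := vsproj h (br x y).
have tE : br x y = vsval t by rewrite vsprojK // (rootspace_opp_br xa).
have at0 := coroot_neq0 xa ya tE xy0.
pose p j := `[< exists k : nat, W j = beta - alpha *+ k >].
pose q j := `[< exists k : int, W j = beta + alpha *~ k >].
have trp : \sum_(j | p j) W j t = 0.
  apply: (bracket_trace tE) => j /asboolP[k Wj].
  - case: k Wj => [|k] Wj.
      have Bj : B`_j \in rootspace beta by rewrite mulr0n subr0 in Wj; rewrite -Wj.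
      by rewrite (xz0 _ _ xa Bj) => k _; rewrite linear0.
    apply: (supported_br xa) => j' Wj'; apply/asboolP; exists k.
    by rewrite Wj' Wj mulrSr opprD addrA subrK.
  - apply: (supported_br ya) => j' Wj'; apply/asboolP; exists k.+1.
    by rewrite Wj' Wj mulrSr opprD addrA.
have trq : \sum_(j | q j) W j t = 0.
  apply: (bracket_trace tE) => j /asboolP[k Wj].
  - apply: (supported_br xa) => j' Wj'; apply/asboolP; exists (k + 1).
    by rewrite Wj' Wj mulrzDr addrA.
  - apply: (supported_br ya) => j' Wj'; apply/asboolP; exists (k - 1).
    by rewrite Wj' Wj mulrzBr addrA.
have pq j : p j -> q j.
  move=> /asboolP[k Wj]; apply/asboolP; exists (- k%:Z).
  by rewrite Wj mulrNz.
pose r := beta t / alpha t.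
have r_ge0 : 0 <= r.
  have := trp => /(congr1 (fun s => s / alpha t)); rewrite mul0r mulr_suml => s0.
  have : 0 <= \sum_(j | p j) r.
    rewrite -[leLHS]s0; apply: ler_sum => j /asboolP[k ->].
    rewrite add_lfunE opp_lfunE -scaler_nat scale_lfunE /= mulrBl mulfK //.
    by rewrite gerBl ler0n.
  rewrite sumr_const pmulrn_lge0 //; apply/card_gt0P; exists i1.
  by apply/asboolP; exists 0%N; rewrite subr0.
have up j : q j && ~~ p j -> 0 < W j t / alpha t.
  case/andP => /asboolP[k Wj] /asboolP np; case: k Wj => [[|k]|k] Wj.
  - by case: np; exists 0%N; rewrite Wj mulr0z subr0 addr0.
  - rewrite Wj add_lfunE -scaler_int scale_lfunE /= mulrDl mulfK //.
    by rewrite ltr_wpDl // ltr0z.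
  - by case: np; exists k.+1; rewrite Wj NegzE mulrNz.
have : \sum_(j | q j && ~~ p j) W j t / alpha t = 0.
  rewrite -mulr_suml; move: trq; rewrite (bigID p) /=.
  rewrite (eq_bigl p) ?trp => [|j]; first by rewrite add0r => ->; rewrite mul0r.
  by have := pq j; case: (p j) => [->|]; rewrite ?andbF.
have qi2 : q i2 && ~~ p i2.
  apply/andP; split; first by apply/asboolP; exists 1; rewrite Wi2 addrC.
  apply/asboolP => -[k]; rewrite Wi2 addrC => /addrI /eqP.
  rewrite -subr_eq0 opprK -mulrS -scaler_nat scaler_eq0 pnatr_eq0 orFb.
  by rewrite (negPf a0).
apply/eqP; rewrite gt_eqF // (bigD1 i2) //= ltr_wpDr ?up //.
by apply: sumr_ge0 => k /andP[/up/ltW].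
Qed.

Lemma basis_neq0 (i : 'I_n) : B`_i != 0.
Proof. by rewrite (free_not0 (basis_free Bb)) // mem_nth ?size_tuple. Qed.

Lemma root_vectorE (i : 'I_n) x : W i != 0 -> x \in rootspace (W i) ->
  x = co i x *: B`_i.
Proof.
move=> Wi /rootspace_supported xi; rewrite {1}(supported_sum xi) (big_pred1 i) // => j.
by apply/eqP/eqP => [/esym /(root_multiplicity1 Wi)->|->].
Qed.

Lemma basis_br_neq0 (i j : 'I_n) : W i != 0 -> W j != 0 ->
  is_weight (W i + W j) -> br B`_i B`_j != 0.
Proof.
move=> Wi Wj Wij; have [||//|x [z [xi zj]]] := @root_bracket_neq0 (W i) (W j) Wi.
- by exists i.
- by exists j.
apply: contraNneq => b0; rewrite (root_vectorE Wi xi) (root_vectorE Wj zj).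
by rewrite lie_brZl linearZ /= b0 !scaler0.
Qed.

Lemma is_root_weight alpha : is_root alpha <-> alpha != 0 /\ is_weight alpha.
Proof.
split=> -[a0]; last first.
  case=> i Wi; split=> //; apply/eqP => r0.
  by have := basis_neq0 i; have := BW i; rewrite Wi r0 memv0 => ->.
rewrite -vpick0 => x0; split=> //; apply: contrapT => nw.
case/eqP: x0; apply: coord_ext => i; rewrite linear0.
have /rootspace_supported := memv_pick (rootspace alpha); apply.
by apply/eqP => Wi; apply: nw; exists i.
Qed.

(** * Abelian ideals of the sum of the nonnegative weight spaces *)

Definition coordinate_space p := <<[seq B`_(i : 'I_n) | i <- enum p]>>%VS.

Lemma coordinate_spaceP p x : x \in coordinate_space p <-> supported p x.
Proof.
split=> [/(coord_span (X := in_tuple _)) -> i npi|/supported_sum->]; last first.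
  apply: memv_suml => i pi; rewrite memvZ // memv_span //.
  by rewrite (map_f (fun i : 'I_n => B`_i)) // mem_enum.
rewrite linear_sum big1 // => k _; rewrite linearZ /=.
have /mapP[j] := mem_nth 0 (ltn_ord k).
rewrite mem_enum => pj ->; rewrite coordB (_ : j == i = false) ?mulr0 //.
by apply: contraNF npi => /eqP <-.
Qed.

Lemma dim_coordinate_space p : \dim (coordinate_space p) = #|p|.
Proof.
have -> : #|p| = size [seq B`_(i : 'I_n) | i <- enum p] by rewrite size_map cardE.
apply/eqP; apply: (catl_free (Y := [seq B`_(i : 'I_n) | i <- enum (predC p)])).
rewrite -map_cat (perm_free (Y := B)) ?(basis_free Bb) //.
rewrite -[X in perm_eq _ X]map_tnth_enum.
have -> : [seq B`_(i : 'I_n) | i <- enum p ++ enum (predC p)] =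
    map (tnth B) (enum p ++ enum (predC p)).
  by apply: eq_map => i; rewrite (tnth_nth 0).
by apply: perm_map; apply/permPl; rewrite {1 2}/enum_mem -enumT; exact: perm_filterC.
Qed.

Variables (b : {vspace L}) (pos : pred 'I_n).
Hypothesis bE : forall x, x \in b <-> supported (fun i => (W i == 0) || pos i) x.
Hypothesis pos_add : forall i j, pos i -> pos j -> W i + W j != 0.
Hypothesis pos_neq0 : forall i, pos i -> W i != 0.
Hypothesis weight_sign : forall i, W i != 0 ->
  exists2 j, pos j & W i = W j \/ W i = - W j.

Definition abelian_upper p :=
  [/\ forall i, p i -> pos i,
      forall i j k, pos i -> p j -> W k = W i + W j -> p k
    & forall i j, p i -> p j -> ~ is_weight (W i + W j)].

Lemma basis_b (i : 'I_n) : pos i -> B`_i \in b.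
Proof.
move=> pi; apply/bE => j; rewrite negb_or => /andP[_ npj].
by rewrite coordB (_ : i == j = false) //; apply: contraNF npj => /eqP <-.
Qed.

Lemma abelian_upper_ideal p : abelian_upper p ->
  is_abelian_ideal b (coordinate_space p).
Proof.
move=> [ppos pup pab]; split; [split|].
- apply/subvP => x /coordinate_spaceP xp; apply/bE => i; rewrite negb_or.
  by case/andP => _ npi; apply: xp; apply: contra npi => /ppos.
- move=> x y /bE xb /coordinate_spaceP yp.
  rewrite (supported_sum xb) lie_br_suml; apply: memv_suml => i pi.
  rewrite lie_brZl memvZ // (supported_sum yp) linear_sum.
  apply: memv_suml => j pj; rewrite linearZ memvZ //=.
  apply/coordinate_spaceP; apply: (supported_br (BW i)) => k Wk.
  case/orP: pi => [/eqP Wi|posi]; last by apply: (pup i j); rewrite // Wk addrC.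
  rewrite Wi addr0 in Wk.
  have Wk0 : W k != 0 by rewrite Wk; apply/pos_neq0/ppos.
  by rewrite (root_multiplicity1 Wk0 Wk).
move=> x y /coordinate_spaceP xp /coordinate_spaceP yp.
rewrite (supported_sum xp) lie_br_suml; apply: big1 => i pi.
rewrite lie_brZl (supported_sum yp) linear_sum big1 ?scaler0 // => j pj.
rewrite linearZ /=; apply/eqP; rewrite scaler_eq0; apply/orP; right.
apply/eqP; apply: coord_ext => k; rewrite linear0.
apply: (supported_br (p := pred0) (BW i)) => // k' Wk'.
by case: (pab i j pi pj); exists k'; rewrite Wk' addrC.
Qed.

Section AbelianIdeal.
Variable I : {vspace L}.
Hypothesis Iid : is_abelian_ideal b I.

Let cartan_b t : t \in h -> t \in b.
Proof.
rewrite -(rootspace0 hc) => /rootspace_supported ht; apply/bE => i.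
by rewrite negb_or => /andP[/ht].
Qed.

(** For a root vector B_j of b, abelianness gives 0 = [t, [t, B_j]], which is
    W_j(t)^2 B_j.  So all weights vanish at t, and t is central. *)
Lemma abelian_ideal_cartan t : t \in I -> t \in h -> t = 0.
Proof.
move=> tI th; have [[Ib Istab] Iab] := Iid; apply: central_eq0 => i.
have tB (j : 'I_n) : br t B`_j = W j (vsproj h t) *: B`_j by exact: rootspace_act.
have pos0 (j : 'I_n) : pos j -> W j (vsproj h t) = 0.
  move=> pj; have BtI : br t B`_j \in I.
    by rewrite lie_brC rpredN Istab // basis_b.
  have := Iab _ _ tI BtI; rewrite {1}tB linearZ /= tB scalerA => /eqP.
  by rewrite scaler_eq0 (negPf (basis_neq0 j)) orbF -expr2 sqrf_eq0 => /eqP.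
rewrite tB; have [->|/weight_sign[j /pos0 pj []->]] := eqVneq (W i) 0.
- by rewrite zero_lfunE scale0r.
- by rewrite pj scale0r.
- by rewrite opp_lfunE pj oppr0 scale0r.
Qed.

(** As I is stable under h, it contains the weight components of x; the one of
    weight 0 vanishes and the others are multiples of basis vectors. *)
Lemma abelian_ideal_coord x (i : 'I_n) : x \in I -> co i x != 0 ->
  pos i && (B`_i \in I).
Proof.
move=> xI xi; have [[Ib Istab] Iab] := Iid.
pose comp gamma := \sum_(j < n | W j == gamma) co j x *: B`_j.
pose ws := undup [seq W j | j <- enum 'I_n].
have xE : x = \sum_(gamma <- ws) comp gamma.
  rewrite /comp (exchange_big_dep predT) //= {1}(coord_expand x).
  apply: eq_bigr => j _; rewrite -big_filter.
  rewrite (_ : [seq g <- ws | _] = [:: W j]) ?big_seq1 //.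
  rewrite (eq_filter (a2 := pred1 (W j))); last by move=> k /=; rewrite eq_sym.
  by rewrite filter_pred1_uniq ?undup_uniq // mem_undup map_f ?mem_enum.
have compR gamma : comp gamma \in rootspace gamma.
  by apply: memv_suml => j /eqP <-; rewrite memvZ.
have compI j : comp (W j) \in I.
  apply: (@commuting_components _ _ _ (fun t : subvs_of h => br (vsval t))
    _ (fun (gamma : dual h) t => gamma t : F) I comp ws).
  - by move=> g g' /dual_separates.
  - by move=> t a u v; rewrite linearP.
  - by move=> t v vI; rewrite Istab // cartan_b ?subvsP.
  - by move=> g t _; move/rootspaceP: (compR g).
  - exact: undup_uniq.
  - by rewrite -xE.
  - by rewrite mem_undup map_f ?mem_enum.
have coi : co i (comp (W i)) = co i x.
  rewrite linear_sum (bigD1 i) //= big1 => [|j /andP[_ /negPf ji]].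
    by rewrite linearZ /= coordB eqxx mulr1 addr0.
  by rewrite linearZ /= coordB ji mulr0.
have [Wi0|Wi0] := eqVneq (W i) 0.
  case/eqP: xi; rewrite -coi (_ : comp _ = 0) ?linear0 //.
  apply: abelian_ideal_cartan => //.
  by rewrite -(rootspace0 hc) -[X in rootspace X]Wi0.
have := root_vectorE Wi0 (compR (W i)); rewrite coi => cE.
have BI : B`_i \in I.
  by have := compI i; rewrite cE rpredZeq (negPf xi).
rewrite BI andbT.
have /subvP/(_ _ BI)/bE/(_ i) := Ib.
rewrite (negPf Wi0) /= coordB eqxx => H; apply: contraT => /H /eqP.
by rewrite oner_eq0.
Qed.

Definition ideal_support i := pos i && (B`_(i : 'I_n) \in I).

Lemma abelian_idealE : I = coordinate_space ideal_support.
Proof.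
apply/vspaceP => x; apply/idP/idP => [xI|/coordinate_spaceP/supported_sum->].
  by apply/coordinate_spaceP => i; apply: contraNeq => /(abelian_ideal_coord xI).
by apply: memv_suml => i /andP[_ BI]; rewrite memvZ.
Qed.

(** Closure under adding positive roots and the absence of two roots with a sum
    that is a root both rest on the nonvanishing of [B_i, B_j]. *)
Lemma abelian_ideal_upper : abelian_upper ideal_support.
Proof.
have [[Ib Istab] Iab] := Iid; split=> [i /andP[]//|i j k pi|i j].
  move=> /andP[pj BI] Wk.
  have wk : is_weight (W i + W j) by exists k.
  have Wk0 : W k != 0 by rewrite Wk pos_add.
  have := basis_br_neq0 (pos_neq0 pi) (pos_neq0 pj) wk.
  have bk : br B`_i B`_j \in rootspace (W k) by rewrite Wk rootspace_br.
  have : br B`_i B`_j \in I by rewrite Istab // basis_b.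
  rewrite (root_vectorE Wk0 bk) scaler_eq0 negb_or rpredZeq => cI /andP[c0 _].
  move: cI; rewrite (negPf c0) /= => BkI.
  by apply: (abelian_ideal_coord BkI); rewrite coordB eqxx oner_eq0.
move=> /andP[pi BiI] /andP[pj BjI] /(basis_br_neq0 (pos_neq0 pi) (pos_neq0 pj)).
by rewrite Iab // eqxx.
Qed.

End AbelianIdeal.

End Weights.

(** * The root system in coordinates over the simple roots *)

(** Coefficients over the simple roots e_2 - e_3, e_3 - e_4, e_4 and
    (e_1 - e_2 - e_3 - e_4) / 2, listed by increasing height. *)
Definition F4_pos : seq (seq nat) :=
 ([:: [:: 0;0;0;1]; [:: 0;0;1;0]; [:: 0;1;0;0]; [:: 1;0;0;0];
  [:: 0;0;1;1]; [:: 0;1;1;0]; [:: 1;1;0;0];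
  [:: 0;1;1;1]; [:: 0;1;2;0]; [:: 1;1;1;0];
  [:: 0;1;2;1]; [:: 1;1;1;1]; [:: 1;1;2;0];
  [:: 0;1;2;2]; [:: 1;1;2;1]; [:: 1;2;2;0];
  [:: 1;1;2;2]; [:: 1;2;2;1];
  [:: 1;2;2;2]; [:: 1;2;3;1];
  [:: 1;2;3;2]; [:: 1;2;4;2]; [:: 1;3;4;2]; [:: 2;3;4;2]])%N.

(** The opposite of the Cartan integer of alpha_k and the coroot of alpha_j for
    k <> j, and 0 on the diagonal: the reflection s_j sends alpha_k to
    alpha_k + (F4_refl_coef k j) alpha_j for k <> j. *)
Definition F4_refl_coef (k j : nat) : nat :=
 (nth 0 (nth [::] [:: [:: 0;1;0;0]; [:: 1;0;2;0]; [:: 0;1;0;1]; [:: 0;0;1;0]] k) j)%N.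

Definition refl_sum (j : nat) (c : seq nat) : nat :=
  sumn [seq F4_refl_coef k j * nth 0 c k | k <- iota 0 4]%N.

(** The action of s_j on coefficients.  The truncated subtraction is harmless
    on the positive roots other than alpha_j, by F4_pos_reflect. *)
Definition reflect_coefs (j : nat) (c : seq nat) : seq nat :=
  mkseq (fun k => if k == j then refl_sum j c - nth 0 c j else nth 0 c k)%N 4.

Definition simple_coefs (j : nat) : seq nat := mkseq (fun k => nat_of_bool (k == j)) 4.

Definition add_coefs (c d : seq nat) : seq nat :=
  mkseq (fun k => nth 0 c k + nth 0 d k)%N 4.

Lemma F4_pos_size c : c \in F4_pos -> size c = 4%N.
Proof. by move=> cP; apply/eqP; apply: (allP (_ : all (fun c => size c == 4%N) F4_pos)). Qed.

Lemma F4_pos_simple (j : 'I_4) : simple_coefs j \in F4_pos.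
Proof. by case: j => -[|[|[|[|]]]]. Qed.

Lemma F4_pos_reflect (j : 'I_4) c : c \in F4_pos -> c != simple_coefs j ->
  [/\ reflect_coefs j c \in F4_pos, reflect_coefs j c != simple_coefs j,
      reflect_coefs j (reflect_coefs j c) = c & (nth 0 c j <= refl_sum j c)%N].
Proof.
pose test j c := [&& reflect_coefs j c \in F4_pos, reflect_coefs j c != simple_coefs j,
   reflect_coefs j (reflect_coefs j c) == c & (nth 0 c j <= refl_sum j c)%N].
have T : all (fun j => all (fun c => (c != simple_coefs j) ==> test j c) F4_pos) (iota 0 4).
  by vm_compute.
move=> cP cj; have /allP/(_ j) := T; rewrite mem_iota ltn_ord => /(_ isT)/allP/(_ c cP).
by rewrite cj => /and4P[-> -> /eqP -> ->].
Qed.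

(** A simple reflection permutes the positive roots other than its own. *)
Lemma F4_pos_reflect_perm (j : 'I_4) :
  perm_eq (map (reflect_coefs j) (rem (simple_coefs j) F4_pos)) (rem (simple_coefs j) F4_pos).
Proof. by case: j => -[|[|[|[|]]]] // ?; vm_compute. Qed.

Section Combination.
Variables (F : numFieldType) (V : lmodType F).
Implicit Types (A : 'I_4 -> V) (c d : seq nat).

Definition comb A c : V := \sum_(k < 4) A k *+ nth 0%N c k.

Definition independent A :=
  forall z : 'I_4 -> F, \sum_k z k *: A k = 0 -> forall k, z k = 0.

Definition reflect_basis (j : 'I_4) A (k : 'I_4) : V :=
  (if k == j then - A j else A k) + A j *+ F4_refl_coef k j.

Lemma comb_simple A (j : 'I_4) : comb A (simple_coefs j) = A j.
Proof.
rewrite /comb (bigD1 j) //= nth_mkseq ?ltn_ord // eqxx mulr1n big1 ?addr0 // => k kj.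
by rewrite nth_mkseq ?ltn_ord // (_ : (k == j :> nat) = false) ?mulr0n //; apply/negbTE.
Qed.

Lemma comb_add A c d : comb A (add_coefs c d) = comb A c + comb A d.
Proof.
by rewrite -big_split; apply: eq_bigr => k _; rewrite nth_mkseq ?ltn_ord // mulrnDr.
Qed.

Lemma comb_inj A c d : independent A -> size c = 4%N -> size d = 4%N ->
  comb A c = comb A d -> c = d.
Proof.
move=> Ai sc sd /eqP; rewrite -subr_eq0 -sumrB => /eqP E.
apply: (@eq_from_nth _ 0%N); first by rewrite sc sd.
rewrite sc => k k4.
have z0 : \sum_(k < 4) ((nth 0%N c k)%:R - (nth 0%N d k)%:R) *: A k = 0.
  by rewrite -[RHS]E; apply: eq_bigr => l _; rewrite scalerBl !scaler_nat.
have /eqP := Ai (fun k : 'I_4 => _) z0 (Ordinal k4).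
by rewrite subr_eq0 eqr_nat => /eqP.
Qed.

Lemma F4_refl_coef_diag (j : 'I_4) : F4_refl_coef j j = 0%N.
Proof. by case: j => -[|[|[|[|]]]]. Qed.

Lemma refl_sumE (j : 'I_4) c :
  refl_sum j c = (\sum_(k < 4) F4_refl_coef k j * nth 0 c k)%N.
Proof.
rewrite /refl_sum sumnE big_map -[iota 0 4]/(index_iota 0 4).
by rewrite (big_mkord xpredT (fun k => F4_refl_coef k j * nth 0 c k)%N).
Qed.

Lemma comb_reflect (j : 'I_4) A c : (nth 0 c j <= refl_sum j c)%N ->
  comb (reflect_basis j A) c = comb A (reflect_coefs j c).
Proof.
move=> le; rewrite /comb /reflect_basis.
under eq_bigr => k _ do rewrite mulrnDl -mulrnA.
rewrite big_split /= sumrMnr -refl_sumE.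
rewrite (bigD1 j) //= [RHS](bigD1 j) //= eqxx nth_mkseq ?ltn_ord // eqxx.
rewrite mulrnBr // mulNrn addrAC; congr (_ + _); first by rewrite addrC.
apply: eq_bigr => k /negPf kj; rewrite kj nth_mkseq ?ltn_ord //.
by rewrite (_ : (k == j :> nat) = false).
Qed.

(** A relation z between the new vectors is a relation z' between the old ones,
    whose coefficients agree with those of z except at j. *)
Lemma independent_reflect (j : 'I_4) A :
  independent A -> independent (reflect_basis j A).
Proof.
move=> Ai z z0.
pose z' l := if l == j then \sum_i z i * (F4_refl_coef i j)%:R - z j else z l.
have z'0 : \sum_k z' k *: A k = 0.
  rewrite -[RHS]z0 /reflect_basis.
  under [RHS]eq_bigr => i _ do rewrite scalerDr -scaler_nat scalerA.
  rewrite big_split /= -scaler_suml (bigD1 j) //= [in RHS](bigD1 j) //= /z' !eqxx.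
  rewrite scalerBl scalerN [RHS]addrC addrA; congr (_ - _ + _).
  by apply: eq_bigr => i /negPf ->.
have zk k : k != j -> z k = 0.
  by move=> /negPf kj; have := Ai _ z'0 k; rewrite /z' kj.
move=> k; have [->|/zk//] := eqVneq k j.
(* z' j = - z j once the other coefficients of z are known to be 0. *)
have := Ai _ z'0 j; rewrite /z' eqxx (bigD1 j) //= F4_refl_coef_diag mulr0 add0r.
rewrite big1 ?sub0r => [/eqP|i /zk->]; last by rewrite mul0r.
by rewrite oppr_eq0 => /eqP.
Qed.

(** * Every height function is dominant for some system of simple roots *)

Variable isroot : V -> Prop.

Definition simple_system A := independent A /\
  forall alpha, isroot alpha <->
    exists2 c, c \in F4_pos & alpha = comb A c \/ alpha = - comb A c.

Lemma simple_system_reflect (j : 'I_4) A :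
  simple_system A -> simple_system (reflect_basis j A).
Proof.
move=> [Ai Ar]; split; first exact: independent_reflect.
have key c : c \in F4_pos -> c != simple_coefs j ->
    comb A c = comb (reflect_basis j A) (reflect_coefs j c).
  move=> cP cj; have [c'P c'j cc' _] := F4_pos_reflect cP cj.
  by have [_ _ _ le] := F4_pos_reflect c'P c'j; rewrite comb_reflect // cc'.
have keyj : comb (reflect_basis j A) (simple_coefs j) = - comb A (simple_coefs j).
  by rewrite !comb_simple /reflect_basis eqxx F4_refl_coef_diag addr0.
move=> alpha; rewrite Ar; split=> -[c cP ac].
  have [cj|cj] := eqVneq c (simple_coefs j).
    exists (simple_coefs j); first exact: F4_pos_simple.
    by rewrite keyj opprK -cj; case: ac; [right|left].
  exists (reflect_coefs j c); first by have [] := F4_pos_reflect cP cj.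
  by rewrite -key.
have [cj|cj] := eqVneq c (simple_coefs j).
  exists (simple_coefs j); first exact: F4_pos_simple.
  by move: ac; rewrite cj keyj opprK => -[]; [right|left].
exists (reflect_coefs j c); first by have [] := F4_pos_reflect cP cj.
have [c'P c'j cc' _] := F4_pos_reflect cP cj.
by rewrite key // cc'.
Qed.

Variable height : {linear V -> F^o}.
Hypothesis height_real : forall alpha, isroot alpha -> height alpha \is Num.real.
Hypothesis height_neq0 : forall alpha, isroot alpha -> height alpha != 0.

(** Induction on the number of positive roots of A of negative height.  If there
    is one, then some A j has negative height; s_j permutes the other positive
    roots and makes A j positive, so it decreases this number by 1. *)
Lemma positive_simple_system A : simple_system A ->
  exists2 A', simple_system A' & forall c, c \in F4_pos -> 0 < height (comb A' c).
Proof.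
have [m] := ubnP (count (fun c => height (comb A c) < 0) F4_pos).
elim: m A => // m IH A; rewrite ltnS => le sA.
have root c : c \in F4_pos -> isroot (comb A c).
  by move=> cP; apply/(proj2 sA); exists c => //; left.
have [/existsP[j Aj]|/existsPn Age0] := boolP [exists j, height (A j) < 0]; last first.
  exists A => // c cP; rewrite lt_def height_neq0 /=; last exact: root.
  rewrite linear_sum sumr_ge0 // => k _; rewrite linearMn mulrn_wge0 //.
  have := Age0 k; rewrite -real_leNgt ?real0 //.
  by rewrite -(comb_simple A); apply: height_real; exact/root/F4_pos_simple.
apply: (IH (reflect_basis j A)); last exact: simple_system_reflect.
apply: leq_trans le.
have Ej a : (count a F4_pos =
    a (simple_coefs j) + count a (rem (simple_coefs j) F4_pos))%N.
  by have /permP -> := perm_to_rem (F4_pos_simple j).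
rewrite !Ej !comb_simple Aj add1n ltnS {1}/reflect_basis eqxx F4_refl_coef_diag addr0.
rewrite (_ : (height (- A j) < 0) = false) ?add0n; last first.
  by rewrite linearN oppr_lt0 (lt_gtF Aj).
have /permP/(_ (fun c => height (comb A c) < 0)) := F4_pos_reflect_perm j.
rewrite count_map => <-; rewrite leq_eqVlt; apply/orP; left; apply/eqP.
apply: eq_in_count => c; rewrite mem_rem_uniq // inE => /andP[cj cP].
have [_ _ _ le'] := F4_pos_reflect cP cj.
by rewrite (comb_reflect A le').
Qed.

End Combination.

(** * From the coordinates of R^4 to the simple roots *)

(** Twice the coordinates of the simple roots, which are integers. *)
Definition F4_simple_table (k l : nat) : int :=
  nth 0 (nth [::] [:: [:: 0;2;-2;0]; [:: 0;0;2;-2]; [:: 0;0;0;2]; [:: 1;-1;-1;-1]] k) l.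

Definition doubled_coords (c : seq nat) : seq int :=
  mkseq (fun l => foldr (fun k s => (nth 0%N c k)%:Z * F4_simple_table k l + s) 0 (iota 0 4)) 4.

Definition sgn (s : bool) : int := if s then -1 else 1.

Definition short_vec s i : seq int := mkseq (fun k => if k == i then 2 * sgn s else 0) 4.
Definition long_vec s t i j : seq int :=
  mkseq (fun k => (if k == i then 2 * sgn s else 0) + (if k == j then 2 * sgn t else 0)) 4.
Definition half_vec (s0 s1 s2 s3 : bool) : seq int := [:: sgn s0; sgn s1; sgn s2; sgn s3].

Definition F4_doubled : seq (seq int) :=
  map doubled_coords F4_pos ++ map (map -%R \o doubled_coords) F4_pos.

Definition bools := [:: false; true].

Lemma mem_bools s : s \in bools. Proof. by case: s. Qed.

Lemma short_vec_mem s (i : 'I_4) : short_vec s i \in F4_doubled.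
Proof.
have T : all (fun s => all (fun i => short_vec s i \in F4_doubled) (iota 0 4)) bools.
  by vm_compute.
by have /allP/(_ _ (mem_bools s))/allP/(_ i) := T; apply; rewrite mem_iota ltn_ord.
Qed.

Lemma long_vec_mem s t (i j : 'I_4) : i != j -> long_vec s t i j \in F4_doubled.
Proof.
have T : all (fun s => all (fun t => all (fun i => all (fun j =>
    (i != j) ==> (long_vec s t i j \in F4_doubled)) (iota 0 4)) (iota 0 4)) bools) bools.
  by vm_compute.
have /allP/(_ _ (mem_bools s))/allP/(_ _ (mem_bools t))/allP/(_ i) := T.
rewrite mem_iota ltn_ord => /(_ isT)/allP/(_ j).
by rewrite mem_iota ltn_ord => /(_ isT) /implyP.
Qed.

Lemma half_vec_mem s0 s1 s2 s3 : half_vec s0 s1 s2 s3 \in F4_doubled.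
Proof. by case: s0 s1 s2 s3 => -[] [] []; vm_compute. Qed.

Lemma F4_doubledP d : d \in F4_doubled ->
  [\/ exists s (i : 'I_4), d = short_vec s i,
      exists s t (i j : 'I_4), i != j /\ d = long_vec s t i j
    | exists s0 s1 s2 s3, d = half_vec s0 s1 s2 s3].
Proof.
have T : all (fun d =>
   [|| has (fun s => has (fun i => d == short_vec s i) (iota 0 4)) bools,
       has (fun s => has (fun t => has (fun i => has (fun j =>
         (i != j) && (d == long_vec s t i j)) (iota 0 4)) (iota 0 4)) bools) bools
     | has (fun s0 => has (fun s1 => has (fun s2 => has (fun s3 =>
         d == half_vec s0 s1 s2 s3) bools) bools) bools) bools]) F4_doubled.
  by vm_compute.
move=> dF; have /allP/(_ d dF)/or3P[] := T.
- move=> /hasP[s _ /hasP[i i4 /eqP ->]]; rewrite mem_iota in i4.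
  by constructor 1; exists s, (Ordinal (i4 : i < 4)%N).
- move=> /hasP[s _ /hasP[t _ /hasP[i i4 /hasP[j j4 /andP[ij /eqP ->]]]]].
  rewrite mem_iota in i4; rewrite mem_iota in j4.
  by constructor 2; exists s, t, (Ordinal (i4 : i < 4)%N), (Ordinal (j4 : j < 4)%N).
move=> /hasP[s0 _ /hasP[s1 _ /hasP[s2 _ /hasP[s3 _ /eqP ->]]]].
by constructor 3; exists s0, s1, s2, s3.
Qed.

Section Coordinates.
Variable F : numFieldType.

Definition of_doubled (d : seq int) : 'rV[F]_4 := \row_l (2%:R^-1 * (nth 0 d l)%:~R).

Definition F4_simple (k : 'I_4) : 'rV[F]_4 :=
  \row_l (2%:R^-1 * (F4_simple_table k l)%:~R).

Lemma comb_F4_simple c : comb F4_simple c = of_doubled (doubled_coords c).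
Proof.
apply/rowP => l; rewrite !mxE nth_mkseq ?ltn_ord // summxE.
have -> : foldr (fun k s => (nth 0%N c k)%:Z * F4_simple_table k l + s) 0 (iota 0 4) =
    \sum_(k < 4) (nth 0%N c k)%:Z * F4_simple_table k l.
  by rewrite !big_ord_recl big_ord0.
rewrite rmorph_sum mulr_sumr; apply: eq_bigr => k _.
by rewrite mulmxnE mxE rmorphM mulrCA -(mulr_natl _ (nth 0%N c k)).
Qed.

Lemma sgnE (s : bool) : (-1) ^+ s = (sgn s)%:~R :> F.
Proof. by case: s; rewrite ?expr1 ?expr0. Qed.

Lemma two_neq0 : 2%:R != 0 :> F. Proof. by rewrite pnatr_eq0. Qed.

Lemma F4_root_doubled (v : 'rV[F]_4) :
  F4_root v <-> exists2 d, d \in F4_doubled & v = of_doubled d.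
Proof.
have deltaE (i l : 'I_4) (s : bool) : ((-1) ^+ s *: e4 F i) 0 l =
    2%:R^-1 * (if l == i :> nat then 2 * sgn s else 0)%:~R.
  rewrite !mxE sgnE eqxx -val_eqE /=; case: eqP => _; last by rewrite !mulr0.
  by rewrite intrM mulKf ?two_neq0 ?mulr1.
have shortE (s : bool) (i : 'I_4) : (-1) ^+ s *: e4 F i = of_doubled (short_vec s i).
  by apply/rowP => l; rewrite deltaE !mxE nth_mkseq ?ltn_ord.
have longE (s t : bool) (i j : 'I_4) : (-1) ^+ s *: e4 F i + (-1) ^+ t *: e4 F j =
    of_doubled (long_vec s t i j).
  by apply/rowP => l; rewrite mxE !deltaE !mxE nth_mkseq ?ltn_ord // intrD mulrDr.
have halfE (s : 'I_4 -> bool) : 2%:R^-1 *: \sum_i (-1) ^+ s i *: e4 F i =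
    of_doubled (half_vec (s (inord 0)) (s (inord 1)) (s (inord 2)) (s (inord 3))).
  apply/rowP => l; rewrite !mxE summxE (bigD1 l) //= big1 ?addr0 => [|i il].
    rewrite !mxE !eqxx mulr1 sgnE; congr (_ * _%:~R).
    rewrite -[half_vec _ _ _ _]/(mkseq (fun k => sgn (s (inord k))) 4).
    by rewrite nth_mkseq ?ltn_ord // inord_val.
  by rewrite !mxE eqxx eq_sym (negPf il) mulr0.
split=> [[[s [i ->]]|[s [t [i [j [ij ->]]]]]|[s ->]]|[d /F4_doubledP[]]].
- by exists (short_vec s i); rewrite ?short_vec_mem.
- by exists (long_vec s t i j); rewrite ?long_vec_mem.
- by eexists; last exact: halfE; rewrite half_vec_mem.
- by move=> [s [i ->]] ->; constructor 1; exists s, i; rewrite shortE.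
- by move=> [s [t [i [j [ij ->]]]]] ->; constructor 2; exists s, t, i, j; rewrite longE.
move=> [s0 [s1 [s2 [s3 ->]]]] ->; constructor 3.
exists (fun i : 'I_4 => nth false [:: s0; s1; s2; s3] i); rewrite halfE.
by rewrite /= !inordK.
Qed.

Lemma of_doubled_opp d : of_doubled (map -%R d) = - of_doubled d.
Proof.
apply/rowP => l; rewrite !mxE -mulrN -rmorphN; congr (_ * _%:~R).
have [ld|ld] := ltnP l (size d); first by rewrite (nth_map 0).
by rewrite !nth_default ?size_map ?oppr0.
Qed.

(** The three families of roots and the combinations of simple roots agree
    after doubling, where the comparison is a computation on integers. *)
Lemma F4_root_comb (v : 'rV[F]_4) : F4_root v <->
  exists2 c, c \in F4_pos & v = comb F4_simple c \/ v = - comb F4_simple c.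
Proof.
rewrite F4_root_doubled /F4_doubled; split=> [[d]|[c cP]].
  rewrite mem_cat => /orP[] /mapP[c cP ->] ->; exists c => //.
    by left; rewrite comb_F4_simple.
  by right; rewrite of_doubled_opp comb_F4_simple.
rewrite comb_F4_simple -of_doubled_opp => -[] ->; eexists; try reflexivity.
  by rewrite mem_cat map_f.
by rewrite mem_cat (map_f (map -%R \o doubled_coords)) ?orbT.
Qed.

Lemma independent_F4_simple : independent F4_simple.
Proof.
move=> z z0.
have col l : (l < 4)%N -> \sum_k z k * (F4_simple_table k l)%:~R = 0.
  move=> l4; have /rowP/(_ (Ordinal l4)) := z0; rewrite !mxE summxE => E.
  apply: (mulfI (invr_neq0 two_neq0)); rewrite mulr0 -[RHS]E mulr_sumr.
  by apply: eq_bigr => k _; rewrite !mxE mulrCA.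
have := col 3 isT; have := col 2 isT; have := col 1%N isT; have := col 0%N isT.
rewrite !big_ord_recl !big_ord0 /F4_simple_table /=.
set z1 := z ord0; set z2 := z (lift _ _); set z3 := z (lift _ _); set z4 := z (lift _ _).
rewrite !mulr0 !addr0 !add0r mulr1 => z40; rewrite z40 !mul0r !addr0.
have cancel2 (u : F) (m : int) : m != 0 -> u * m%:~R = 0 -> u = 0.
  by move=> m0 /eqP; rewrite mulf_eq0 intr_eq0 (negPf m0) orbF => /eqP.
move=> /cancel2 z10; rewrite z10 // mul0r add0r => /cancel2 z20.
rewrite z20 // mul0r add0r => /cancel2 z30.
case=> -[|[|[|[|//]]]] i4.
- by rewrite -z10 //; congr z; apply: val_inj.
- by rewrite -z20 //; congr z; apply: val_inj.
- by rewrite -z30 //; congr z; apply: val_inj.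
- by rewrite -z40; congr z; apply: val_inj.
Qed.

End Coordinates.

(** * Enumeration of the abelian upper sets of positive roots *)

Definition extends_abelian (c : seq nat) (S : seq (seq nat)) : bool :=
  all (fun d => (add_coefs c d \in F4_pos) ==> (add_coefs c d \in S)) F4_pos &&
  all (fun d => add_coefs c d \notin F4_pos) S.

(** When the sums of c with positive roots come after c in the list, the
    condition on the members of a set is a condition on each member and on the
    members that come later. *)
Fixpoint abelian_sets (l : seq (seq nat)) : seq (seq (seq nat)) :=
  if l is c :: l' then
    let shorter := abelian_sets l' in
    shorter ++ [seq c :: X | X <- shorter & extends_abelian c X]
  else [:: [::]].

Definition F4_abelian_sets := abelian_sets F4_pos.

Fixpoint sums_come_later (l : seq (seq nat)) : bool :=
  if l is c :: l' then
    all (fun d => (add_coefs c d \in F4_pos) ==> (add_coefs c d \in l')) F4_pos &&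
    sums_come_later l'
  else true.

(** The sum of a root c and of a positive root has larger height than c, so in
    F4_pos it comes after c; this makes the enumeration exhaustive. *)
Lemma mem_F4_abelian_sets (a : pred (seq nat)) :
  (forall c d, c \in F4_pos -> d \in F4_pos -> a c ->
     add_coefs c d \in F4_pos -> a (add_coefs c d)) ->
  (forall c d, c \in F4_pos -> d \in F4_pos -> a c -> a d ->
     add_coefs c d \notin F4_pos) ->
  filter a F4_pos \in F4_abelian_sets.
Proof.
move=> aU aA.
suff gen l : {subset l <= F4_pos} -> sums_come_later l -> filter a l \in abelian_sets l.
  by apply: gen => //; vm_compute.
elim: l => // c l IH sub; rewrite [sums_come_later _]/(_ && _) => /andP[/allP oc ol].
have cP : c \in F4_pos by apply: sub; rewrite inE eqxx.
have subl : {subset l <= F4_pos} by move=> d dl; apply: sub; rewrite inE dl orbT.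
have {}IH := IH subl ol; rewrite -[filter a _]/(if a c then c :: filter a l else filter a l).
rewrite [abelian_sets _]/(_ ++ _) mem_cat.
case: ifP => [ac|]; last by rewrite IH.
apply/orP; right; apply: map_f; rewrite mem_filter IH andbT.
apply/andP; split; apply/allP => d.
  move=> dP; apply/implyP => cdP; rewrite mem_filter aU //=.
  by have /implyP := oc d dP; apply.
by rewrite mem_filter => /andP[ad /subl dP]; apply: aA.
Qed.

Lemma F4_abelian_setsP S : S \in F4_abelian_sets ->
  [/\ S = filter (mem S) F4_pos,
      forall c d, c \in F4_pos -> d \in S -> add_coefs c d \in F4_pos ->
        add_coefs c d \in S
    & forall c d, c \in S -> d \in S -> add_coefs c d \notin F4_pos].
Proof.
have T : all (fun S : seq (seq nat) => [&& S == filter (mem S) F4_pos,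
    all (fun c => all (fun d => (add_coefs c d \in F4_pos) ==> (add_coefs c d \in S)) S) F4_pos
  & all (fun c => all (fun d => add_coefs c d \notin F4_pos) S) S]) F4_abelian_sets.
  by vm_compute.
move=> SE.
have H := allP T S SE.
case/and3P: H => H1 H2 H3.
split.
- by apply/eqP.
- move=> c d cS dS cd.
  have H := allP H2 c cS.
  have H' := allP H d dS.
  exact: (implyP H' cd).
move=> c d cS dS.
have H := allP H3 c cS.
exact: (allP H d dS).
Qed.

Lemma F4_abelian_sets_uniq : uniq F4_abelian_sets.
Proof. by vm_compute. Qed.

Lemma F4_abelian_sets_size : size F4_abelian_sets = 16%N.
Proof. by vm_compute. Qed.

Lemma F4_abelian_sets_count m :
  size [seq X <- F4_abelian_sets | size X == m] =
  nth 0%N [:: 1; 1; 1; 1; 1; 2; 2; 3; 3; 1]%N m.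
Proof.
have [m10|m10] := ltnP m 10.
  have /allP/(_ m) : all (fun m => size [seq X <- F4_abelian_sets | size X == m] ==
     nth 0%N [:: 1; 1; 1; 1; 1; 2; 2; 3; 3; 1]%N m) (iota 0 10) by vm_compute.
  by rewrite mem_iota => /(_ m10)/eqP.
rewrite [RHS]nth_default //; apply/eqP; rewrite size_filter -leqn0 leqNgt -has_count.
have /allP lt10 : all (fun S => size S < 10)%N F4_abelian_sets by vm_compute.
by apply/hasPn => S /lt10; apply: contraTneq => ->; rewrite -leqNgt.
Qed.

(** * Abelian ideals and abelian upper sets *)

Section Ideals.
Variables (F : numFieldType) (L : lieAlgebra F) (h b : {vspace L}).
Variables (n : nat) (B : n.-tuple L) (W : 'I_n -> dual h).
Variables (A : 'I_4 -> dual h) (height : {linear dual h -> F^o}).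
Hypothesis g_simple : is_simple L.
Hypothesis hc : is_cartan h.
Hypothesis Bb : basis_of fullv B.
Hypothesis BW : forall i : 'I_n, B`_i \in rootspace (W i).
Hypothesis Ai : independent A.
Hypothesis Aheight : forall c, c \in F4_pos -> 0 < height (comb A c).
Hypothesis weight_comb : forall i, W i != 0 ->
  exists2 c, c \in F4_pos & W i = comb A c \/ W i = - comb A c.
Hypothesis comb_weight : forall c, c \in F4_pos -> is_weight W (comb A c).

Definition roots_of (S : seq (seq nat)) : seq (dual h) := [seq comb A c | c <- S].
Definition in_roots S : pred 'I_n := fun i => W i \in roots_of S.
Definition ideal_of S : {vspace L} := coordinate_space B (in_roots S).

Hypothesis bE : forall x,
  x \in b <-> supported B (fun i => (W i == 0) || in_roots F4_pos i) x.

Let height_real i : height (W i) \is Num.real.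
Proof.
have [->|/weight_comb[c /Aheight c0 [->|->]]] := eqVneq (W i) 0.
- by rewrite linear0 real0.
- by rewrite gtr0_real.
- by rewrite linearN realN gtr0_real.
Qed.

Let height_eq0 i : height (W i) = 0 -> W i = 0.
Proof.
move=> h0; apply/eqP; apply: contraT => /weight_comb[c /Aheight c0 Wi].
by case: Wi h0 => ->; rewrite ?linearN => /eqP; rewrite ?oppr_eq0 gt_eqF.
Qed.

Let pos_height i : in_roots F4_pos i -> 0 < height (W i).
Proof. by move=> /mapP[c /Aheight c0 ->]. Qed.

Let pos_add i j : in_roots F4_pos i -> in_roots F4_pos j -> W i + W j != 0.
Proof.
move=> /pos_height i0 /pos_height j0.
apply/eqP => /(congr1 height)/eqP; rewrite linearD linear0.
by rewrite gt_eqF // addr_gt0.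
Qed.

Let pos_neq0 i : in_roots F4_pos i -> W i != 0.
Proof.
by move=> /pos_height; apply: contraTneq => ->; rewrite linear0 ltxx.
Qed.

Let weight_sign i : W i != 0 ->
  exists2 j, in_roots F4_pos j & W i = W j \/ W i = - W j.
Proof.
move=> /weight_comb[c cP Wi]; have [j Wj] := comb_weight cP.
by exists j; rewrite ?Wj // /in_roots Wj map_f.
Qed.

Let comb_eq c d : c \in F4_pos -> d \in F4_pos -> comb A c = comb A d -> c = d.
Proof. by move=> /F4_pos_size cs /F4_pos_size ds; apply: comb_inj. Qed.

Lemma comb_add_weight c d : c \in F4_pos -> d \in F4_pos ->
  is_weight W (comb A c + comb A d) <-> add_coefs c d \in F4_pos.
Proof.
move=> cP dP; rewrite -comb_add; split=> [[i Wi]|/comb_weight//].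
have ht : 0 < height (W i).
  by rewrite Wi comb_add linearD addr_gt0 ?Aheight.
have Wi0 : W i != 0 by apply: contraTneq ht => ->; rewrite linear0 ltxx.
have [e eP [We|We]] := weight_comb Wi0; last first.
  by move: ht; rewrite We linearN oppr_gt0 (lt_gtF (Aheight eP)).
suff -> : add_coefs c d = e by [].
by apply: (comb_inj Ai); rewrite ?size_mkseq ?(F4_pos_size eP) // -Wi.
Qed.

Let sub_pos S : S \in F4_abelian_sets -> {subset S <= F4_pos}.
Proof.
by move=> /F4_abelian_setsP[-> _ _] c; rewrite mem_filter => /andP[].
Qed.

Lemma ideal_ofP S : S \in F4_abelian_sets -> is_abelian_ideal b (ideal_of S).
Proof.
move=> SE; have sP := sub_pos SE; have [_ SU SA] := F4_abelian_setsP SE.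
apply: (abelian_upper_ideal hc Bb BW g_simple height_real height_eq0 bE pos_neq0).
split=> [i /mapP[c /sP cP Wi]|i j k /mapP[c cP Wi] /mapP[d dS Wj] Wk|
         i j /mapP[c cS Wi] /mapP[d dS Wj]].
- by rewrite /in_roots Wi map_f.
- have wk : is_weight W (comb A c + comb A d) by exists k; rewrite Wk Wi Wj.
  rewrite /in_roots Wk Wi Wj -comb_add map_f // SU //.
  exact/(comb_add_weight cP (sP _ dS)).
- rewrite Wi Wj => /(comb_add_weight (sP _ cS) (sP _ dS)).
  by rewrite (negPf (SA c d cS dS)).
Qed.

Lemma abelian_ideal_of I : is_abelian_ideal b I ->
  exists2 S, S \in F4_abelian_sets & I = ideal_of S.
Proof.
move=> Iid; pose p := ideal_support B (in_roots F4_pos) I.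
have IE : I = coordinate_space B p.
  exact: (abelian_idealE hc Bb BW g_simple height_real height_eq0 bE weight_sign Iid).
have [ppos pU pA] := abelian_ideal_upper hc Bb BW g_simple height_real height_eq0
  bE pos_add pos_neq0 weight_sign Iid.
pose a c := [exists i, (W i == comb A c) && p i].
have aP c : a c -> exists2 i, W i = comb A c & p i.
  by move=> /existsP[i /andP[/eqP Wi pi]]; exists i.
have SE : filter a F4_pos \in F4_abelian_sets.
  apply: mem_F4_abelian_sets => [c d cP dP /aP[i Wi pi] cd|c d cP dP /aP[i Wi pi] /aP[j Wj pj]].
    have [k Wk] := comb_weight cd; have [j Wj] := comb_weight dP.
    apply/existsP; exists k; rewrite Wk eqxx /=.
    apply: (pU j i) => //; first by rewrite /in_roots Wj map_f.
    by rewrite Wk comb_add Wi Wj addrC.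
  apply/negP => cd; apply: (pA i j) => //.
  by rewrite Wi Wj; apply/(comb_add_weight cP dP).
exists (filter a F4_pos) => //.
have memS c : (c \in filter a F4_pos) = a c && (c \in F4_pos) by rewrite mem_filter.
move: (filter a F4_pos) memS {SE} => S memS.
suff pS : p =1 in_roots S.
  by rewrite {1}IE /ideal_of /coordinate_space (eq_enum pS).
move=> i; apply/idP/mapP => [pi|[c]].
  have /mapP[c cP Wi] := ppos i pi; exists c => //.
  by rewrite memS cP andbT; apply/existsP; exists i; rewrite Wi eqxx.
rewrite memS => /andP[/aP[j Wj pj] cP] Wi.
suff -> : i = j by [].
apply: (root_multiplicity1 hc Bb BW g_simple height_real height_eq0); last by rewrite Wi Wj.
by rewrite Wi -Wj; apply: pos_neq0; apply: ppos.
Qed.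

Lemma ideal_of_inj : {in F4_abelian_sets &, injective ideal_of}.
Proof.
have sub S S' : S \in F4_abelian_sets -> S' \in F4_abelian_sets ->
    ideal_of S = ideal_of S' -> {subset S <= S'}.
  move=> SE SE' JE c cS; have cP := sub_pos SE cS.
  have [i Wi] := comb_weight cP.
  have : B`_i \in ideal_of S'.
    rewrite -JE memv_span // (map_f (fun i : 'I_n => B`_i)) // mem_enum.
    by rewrite unfold_in /in_roots Wi map_f.
  move/(coordinate_spaceP Bb)/(_ i); rewrite (coordB Bb) eqxx /in_roots => H.
  have /mapP[d dS] : W i \in roots_of S'.
    by apply: contraT => /H /eqP; rewrite oner_eq0.
  by rewrite Wi => /(comb_eq cP (sub_pos SE' dS)) ->.
move=> S S' SE SE' JE.
have [-> _ _] := F4_abelian_setsP SE; have [-> _ _] := F4_abelian_setsP SE'.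
apply: eq_filter => c; apply/idP/idP; first exact: (sub S S').
exact: (sub S' S).
Qed.

Lemma dim_ideal_of : {in F4_abelian_sets, forall S, \dim (ideal_of S) = size S}.
Proof.
move=> S SE; have sP := sub_pos SE; have [SF _ _] := F4_abelian_setsP SE.
rewrite (dim_coordinate_space Bb) cardE -(size_map W) -(size_map (comb A) S).
have posS i : in_roots S i -> in_roots F4_pos i.
  by move=> /mapP[c /sP cP Wi]; rewrite /in_roots Wi map_f.
apply/perm_size/uniq_perm.
- rewrite map_inj_in_uniq ?enum_uniq // => i j; rewrite mem_enum => iS _ Wij.
  apply: (root_multiplicity1 hc Bb BW g_simple height_real height_eq0 _ Wij).
  exact/pos_neq0/posS.
- rewrite map_inj_in_uniq => [|c d /sP cP /sP dP]; last exact: comb_eq.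
  by rewrite SF filter_uniq.
move=> alpha; apply/mapP/idP => [[i iS ->]|/mapP[c cS ->]].
  by move: iS; rewrite mem_enum.
have [i Wi] := comb_weight (sP _ cS); exists i; last by rewrite Wi.
by rewrite mem_enum unfold_in /in_roots Wi map_f.
Qed.

End Ideals.

(** * Abelian ideals of a Borel subalgebra of type F_4 *)

Section Height.
Variables (F : numFieldType) (L : lieAlgebra F) (h : {vspace L}) (D : seq (dual h)).
Hypothesis baseD : is_base D.

(** The sum of the coordinates on the base. *)
Lemma base_height : exists ht : {linear dual h -> F^o},
  forall alpha, alpha != 0 -> nat_comb D alpha -> 0 < ht alpha.
Proof.
pose ht (alpha : dual h) : F^o := \sum_(j < size D) coord (in_tuple D) j alpha.
have ht_lin : linear ht.
  move=> a u v; rewrite /ht scaler_sumr -big_split; apply: eq_bigr => j _.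
  by rewrite linearP.
pose htL := GRing.isLinear.Build F (dual h) F^o *:%R ht ht_lin.
exists (HB.pack ht htL : {linear dual h -> F^o}) => alpha a0 [c aE] /=.
have [/basis_free fD _ _] := baseD.
have -> : ht alpha = (\sum_i c i)%:R.
  rewrite aE /ht natr_sum; apply: eq_bigr => j _.
  rewrite linear_sum (bigD1 j) //= big1 => [|i /negPf ij].
    by rewrite raddfMn /= (coord_free (X := in_tuple D)) // eqxx addr0.
  by rewrite raddfMn /= (coord_free (X := in_tuple D)) // ij mul0rn.
rewrite ltr0n lt0n; apply: contra a0; rewrite sum_nat_eq0 => /forallP c0.
by rewrite aE big1 // => i _; have /eqP -> := c0 i; rewrite mulr0n.
Qed.

End Height.

(** The image under the given isomorphism of the standard simple roots. *)
Lemma F4_simple_system (F : numFieldType) (L : lieAlgebra F) (h : {vspace L}) :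
  roots_of_type_F4 h ->
  exists A : 'I_4 -> dual h, simple_system (@is_root _ _ h) A.
Proof.
move=> [phi [/eqP phi_inj _ phi_root]].
have phi_comb c : phi (comb (@F4_simple F) c) = comb (phi \o @F4_simple F) c.
  by rewrite linear_sum; apply: eq_bigr => k _; rewrite linearMn.
exists (phi \o @F4_simple F); split=> [z z0|alpha].
  apply: independent_F4_simple; apply: (lker0P phi_inj).
  rewrite linear0 linear_sum -[RHS]z0; apply: eq_bigr => k _.
  by rewrite linearZ.
rewrite phi_root; split=> [[v /F4_root_comb[c cP vE] ->]|[c cP aE]].
  exists c => //; case: vE => ->; [left; exact: phi_comb | right].
  by rewrite linearN; congr (- _); exact: phi_comb.
case: aE => ->; [exists (comb (@F4_simple F) c)|exists (- comb (@F4_simple F) c)].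
- by apply/F4_root_comb; exists c => //; left.
- by rewrite phi_comb.
- by apply/F4_root_comb; exists c => //; right.
- by rewrite linearN; congr (- _); exact/esym/phi_comb.
Qed.

(** The positive roots of the base D are those of positive height, hence the
    standard positive roots of the system of simple roots A. *)
Theorem F4_abelian_ideals (F : numFieldType) (L : lieAlgebra F) (b : {vspace L}) :
  is_simple L -> of_type_F4 L -> is_borel b ->
  exists J : seq (seq nat) -> {vspace L},
  [/\ forall I, is_abelian_ideal b I <-> exists2 S, S \in F4_abelian_sets & I = J S,
      {in F4_abelian_sets &, injective J}
    & {in F4_abelian_sets, forall S, \dim (J S) = size S}].
Proof.
move=> sL [_ F4L] [h [D [s [hc baseD sP bE]]]].
have [n [B [W [Bb BW]]]] := cartan_weight_basis hc.
have [ht ht_pos] := base_height baseD.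
have [_ _ root_sign] := baseD.
have ht_root alpha : is_root alpha ->
    0 < ht alpha /\ nat_comb D alpha \/ ht alpha < 0 /\ ~ nat_comb D alpha.
  move=> ra; have a0 : alpha != 0 by case: ra.
  have [an|nan] := pselect (nat_comb D alpha); first by left; split; first exact: ht_pos.
  have [//|/ht_pos] := root_sign _ ra.
  by rewrite oppr_eq0 linearN oppr_gt0 => /(_ a0) a_lt0; right.
have [A0 sA0] := F4_simple_system (F4L h hc).
have [||A [Ai Aroot] Apos] := positive_simple_system (height := ht) _ _ sA0.
- by move=> alpha /ht_root[] [h0 _]; [exact: gtr0_real | exact: ltr0_real].
- by move=> alpha /ht_root[] [h0 _]; [rewrite gt_eqF | rewrite lt_eqF].
have Awt i : W i != 0 ->
    exists2 c, c \in F4_pos & W i = comb A c \/ W i = - comb A c.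
  by move=> Wi; apply/Aroot/(is_root_weight Bb BW); split=> //; exists i.
have wtA c : c \in F4_pos -> is_weight W (comb A c).
  move=> cP; suff /(is_root_weight Bb BW)[] : is_root (comb A c) by [].
  by apply/Aroot; exists c => //; left.
have sE alpha : alpha \in s = (alpha \in roots_of A F4_pos).
  apply/idP/mapP => [/sP[ra an]|[c cP ->]].
    have [c cP [->|ac]] := (Aroot alpha).1 ra; first by exists c.
    have := Apos c cP; have [[h0 _]|[_ /(_ an)//]] := ht_root _ ra.
    by move: h0; rewrite ac linearN oppr_gt0 => /lt_gtF ->.
  have rc : is_root (comb A c) by apply/Aroot; exists c => //; left.
  apply/sP; split=> //; have [[]//|[h0 _]] := ht_root _ rc.
  by move: h0; rewrite (lt_gtF (Apos c cP)).
have bE' x : x \in b <->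
    supported B (fun i => (W i == 0) || in_roots W A F4_pos i) x.
  rewrite bE -(coordinate_spaceP Bb); set V := coordinate_space _ _.
  suff -> : (h + \sum_(alpha <- s) rootspace alpha)%VS = V by [].
  have rV alpha : (alpha == 0) || (alpha \in s) -> (rootspace alpha <= V)%VS.
    move=> ha; apply/subvP => y /(rootspace_supported Bb BW) ys.
    apply/(coordinate_spaceP Bb) => i np; apply: ys; apply: contra np => /eqP Wi.
    by rewrite /in_roots Wi -sE.
  apply/eqP; rewrite eqEsubv subv_add -{1}(rootspace0 hc) rV ?eqxx //=.
  apply/andP; split.
    rewrite big_seq; elim/big_ind: _ => [|U1 U2 h1 h2|alpha ha].
    - exact: sub0v.
    - by rewrite subv_add h1.
    - by rewrite rV // ha orbT.
  apply/span_subvP => _ /mapP[i pi ->]; move: pi; rewrite mem_enum.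
  case/orP => [/eqP Wi|].
    have Bh : B`_i \in h by rewrite -(rootspace0 hc) -[X in rootspace X]Wi.
    by apply: subvP Bh; exact: addvSl.
  rewrite /in_roots -sE => Wis; apply: subvP (BW i); apply: subv_trans (addvSr _ _).
  elim: s Wis {sP bE sE rV} => // al s' IH; rewrite inE big_cons.
  case/orP => [/eqP->|/IH H]; first exact: addvSl.
  exact: subv_trans H (addvSr _ _).
exists (ideal_of B W A); split.
- move=> I; split=> [|[S SE ->]].
    exact: (abelian_ideal_of sL hc Bb BW Ai Apos Awt wtA bE').
  exact: (ideal_ofP sL hc Bb BW Ai Apos Awt wtA bE').
- exact: (ideal_of_inj Bb Ai wtA).
exact: (dim_ideal_of sL hc Bb BW Ai Apos Awt wtA).
Qed.

Lemma card_eq_seq (T : Type) (X : eqType) (E : seq X) (J : X -> T) :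
  uniq E -> {in E &, injective J} ->
  ([set I | exists2 x, x \in E & I = J x] #= `I_(size E))%classic%card.
Proof.
case: E => [|x0 E'] uE Jinj.
  rewrite (_ : [set I | _]%classic = set0); first by rewrite II0.
  by apply/seteqP; split=> // I [].
set E := x0 :: E' in uE Jinj *.
have -> : [set I | exists2 x, x \in E & I = J x]%classic =
    [set J (nth x0 E k) | k in `I_(size E)]%classic.
  apply/seteqP; split=> I [] => [x xE ->|k kE <-].
    exists (index x E); last by rewrite nth_index.
    by rewrite -index_mem in xE.
  by exists (nth x0 E k); first exact: mem_nth.
apply: inj_card_eq => i j; rewrite !inE => iE jE.
by move/(Jinj _ _ (mem_nth x0 iE) (mem_nth x0 jE))/eqP; rewrite nth_uniq // => /eqP.
Qed.

Local Open Scope classical_set_scope.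
Local Open Scope card_scope.

Theorem mainTheorem6 (R : realType) (g : lieAlgebra R[i]) (b : {vspace g})
    (g_simple : is_simple g) (g_F4 : of_type_F4 g) (b_borel : is_borel b) :
  [/\ forall m : nat, (m < 10)%N ->
        [set I : {vspace g} | is_abelian_ideal b I /\ \dim I = m]
          #= `I_(nth 0%N [:: 1; 1; 1; 1; 1; 2; 2; 3; 3; 1]%N m),
      forall m : nat, (10 <= m)%N ->
        [set I : {vspace g} | is_abelian_ideal b I /\ \dim I = m] #= `I_0
    & [set I : {vspace g} | is_abelian_ideal b I] #= `I_16].
Proof.
have [J [JP Jinj Jdim]] := F4_abelian_ideals (F := R[i]) g_simple g_F4 b_borel.
have count m : [set I : {vspace g} | is_abelian_ideal b I /\ \dim I = m]
    #= `I_(nth 0%N [:: 1; 1; 1; 1; 1; 2; 2; 3; 3; 1]%N m).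
  rewrite -F4_abelian_sets_count; set E := [seq X <- _ | _].
  rewrite (_ : [set I | _] = [set I | exists2 S, S \in E & I = J S]).
    apply: card_eq_seq; first exact/filter_uniq/F4_abelian_sets_uniq.
    by move=> S S'; rewrite !mem_filter => /andP[_ SE] /andP[_ SE']; exact: Jinj.
  apply/seteqP; split=> I /=.
    move=> [/JP[S SE ->] dm]; exists S => //.
    by rewrite mem_filter SE -(Jdim S SE) dm eqxx.
  move=> [S]; rewrite mem_filter => /andP[/eqP Sm SE] ->.
  by split; [apply/JP; exists S | rewrite Jdim].
split=> [m _|m m10|]; first exact: count.
  by have := count m; rewrite nth_default.
rewrite -F4_abelian_sets_size.
rewrite (_ : [set I | _] = [set I | exists2 S, S \in F4_abelian_sets & I = J S]).
  exact: card_eq_seq F4_abelian_sets_uniq Jinj.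
by apply/seteqP; split=> I /= /JP.
Qed.
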